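(* Let $\beta\equiv\beta^{(4)}$ be a normalized nc sequence with a moment matrix $\mathcal M_2$ of rank 6 satisfying the column relation $\mathbb Y^2=\mathbf 1-\mathbb X^2$. Then $\beta$ admits a nc measure if and only if $\mathcal M_2$ is positive semidefinite and one of the following is true: (1) $\beta_X=\beta_Y=\beta_{X^3}=\beta_{X^2Y}=0$. Moreover, in this case there exists a nc measure of type $(4,1)$. (2) There exist $a_1\in(0,1)$ and $a_2\in\left(-2\sqrt{a_1(1-a_1)},\,2\sqrt{a_1(1-a_1)}\right)$ such that $$M:=\mathcal M_2-\xi\,\mathcal M_2^{(X,Y)}$$ is a positive semidefinite cm moment matrix satisfying $\mathrm{rank}\,M\le\mathrm{card}\,\mathcal V_M$, where $$X=\begin{pmatrix}\sqrt{a_1}&0\\0&-\sqrt{a_1}\end{pmatrix},\quad Y=\sqrt{1-a_1}\begin{pmatrix}\frac a2&\frac12\sqrt{4-a^2}\\\frac12\sqrt{4-a^2}&-\frac a2\end{pmatrix},\quad a=\frac{a_2}{\sqrt{a_1(1-a_1)}},$$ and $\xi>0$ is the smallest positive number such that the rank of $\mathcal M_2-\xi\mathcal M_2^{(X,Y)}$ is smaller than the rank of $\mathcal M_2$.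
   Context: Words are elements of the free monoid on noncommuting letters $X,Y$; $|w|$ is the length of $w$, $w^*$ its reverse, and $v,w$ are cyclically equivalent if $v$ is a cyclic permutation of $w$. A sequence $\beta\equiv\beta^{(4)}=(\beta_w)_{|w|\le4}$ is a family of real numbers with $\beta_v=\beta_w$ for cyclically equivalent $v,w$ and $\beta_w=\beta_{w^*}$. It is normalized if $\beta_1=1$, a nc sequence if $\beta_{X^2Y^2}\ne\beta_{XYXY}$, and a cm sequence if $\beta_{X^2Y^2}=\beta_{XYXY}$. Its moment matrix $\mathcal M_2$ is the symmetric $7\times7$ matrix with rows and columns indexed by $1,X,Y,X^2,XY,YX,Y^2$ and $(U,V)$ entry $\beta_{U^*V}$; the column indexed by $w$ is denoted $w(\mathbb X,\mathbb Y)$, $\mathbf 1$ is the column indexed by the empty word, and ''satisfies a relation'' means that the corresponding linear relation between columns holds. A cm moment matrix is the moment matrix of a (not necessarily normalized) cm sequence. For a pair $(X,Y)$ of real symmetric $t\times t$ matrices, $\mathcal M_2^{(X,Y)}$ is the moment matrix of the sequence $\beta_w=\mathrm{Tr}(w(X,Y))$, where $\mathrm{Tr}(A)=\frac1t\mathrm{tr}(A)$. For a cm moment matrix $M$, the variety associated to $M$ is $\mathcal V_M=\bigcap\{(x,y)\in\mathbb R^2: g(x,y)=0\}$, the intersection over all $g\in\mathbb R[x,y]$ of degree $\le2$ such that $g(\mathbb X,\mathbb Y)=\mathbf 0$ in the column space of $M$ (for $g=\sum a_{ij}x^iy^j$, $g(\mathbb X,\mathbb Y)=\sum a_{ij}\mathbb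 X^i\mathbb Y^j$). A representing measure for $\beta$ consists of finitely many pairs $(A_i,B_i)$ (atoms) of real symmetric $t_i\times t_i$ matrices ($t_i$ is the size) and numbers $\lambda_i>0$ with $\sum_i\lambda_i=1$ and $\beta_w=\sum_i\lambda_i\mathrm{Tr}(w(A_i,B_i))$ for all $|w|\le4$. It is of type $(m_1,\dots,m_r)$ if it has exactly $m_i$ atoms of size $i$ and $m_r\neq0$. It is minimal if no other representing measure has smaller type, where types are compared first by $r$, then by $m_r$, then $m_{r-1}$, ..., then $m_1$. $\beta$ admits a nc measure if it has a minimal representing measure of type $(m_1,\dots,m_r)$ with $r>1$; for a nc sequence $\beta$, any representing measure is called a nc measure. *)

(* Defs.v *)
From mathcomp Require Import all_boot all_order all_algebra.
From mathcomp Require Import boolp classical_sets functions cardinality reals.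

Set Implicit Arguments.
Unset Strict Implicit.
Unset Printing Implicit Defensive.

Import Order.TTheory GRing.Theory Num.Theory.
Local Open Scope classical_set_scope.
Local Open Scope ring_scope.

(* Words in two noncommuting letters; the involution w^* is [rev w], and the
   cyclic permutations of w are the [rot k w]. *)
Definition word := seq bool.
Definition lX : bool := false.
Definition lY : bool := true.

Section TracialMoments.
Variable R : realType.
Implicit Types (beta : word -> R) (w : word).

(* A degree 4 sequence is a total function on words of which only the values
   at words of length at most 4 are ever constrained or used. *)
Definition tracial_seq beta : Prop :=
  (forall w k, (size w <= 4)%N -> beta (rot k w) = beta w) /\
  (forall w, (size w <= 4)%N -> beta (rev w) = beta w).

Definition normalized beta : Prop := beta [::] = 1.

Definition nc_seq beta : Prop :=
  tracial_seq beta /\ beta [:: lX; lX; lY; lY] <> beta [:: lX; lY; lX; lY].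

Definition cm_seq beta : Prop :=
  tracial_seq beta /\ beta [:: lX; lX; lY; lY] = beta [:: lX; lY; lX; lY].

Definition basis : 7.-tuple word :=
  [tuple [::]; [:: lX]; [:: lY];
         [:: lX; lX]; [:: lX; lY]; [:: lY; lX]; [:: lY; lY]].

Definition moment_mx beta : 'M[R]_7 :=
  \matrix_(i, j) beta (rev (tnth basis i) ++ tnth basis j).

(* Meaningful only for w \in basis. *)
Definition mcol (M : 'M[R]_7) w : 'cV[R]_7 := col (inord (index w basis)) M.

Definition psdmx n (A : 'M[R]_n) : Prop :=
  A^T = A /\ forall v : 'cV[R]_n, 0 <= (v^T *m A *m v) 0 0.

Definition cm_moment_mx (M : 'M[R]_7) : Prop :=
  exists2 gamma, cm_seq gamma & M = moment_mx gamma.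

(* A polynomial g(x, y) is an element of {poly {poly R}} whose outer variable
   is x: the coefficient of x^i y^j is g`_i`_j. *)
Definition deg_le2 (g : {poly {poly R}}) : Prop :=
  forall i j, (2 < i + j)%N -> g`_i`_j = 0.

Definition column_eval (M : 'M[R]_7) (g : {poly {poly R}}) : 'cV[R]_7 :=
  \sum_(i < 3) \sum_(j < 3 | (i + j <= 2)%N)
    g`_i`_j *: mcol M (nseq i lX ++ nseq j lY).

Definition variety (M : 'M[R]_7) : set (R * R) :=
  [set p | forall g : {poly {poly R}},
     deg_le2 g -> column_eval M g = 0 -> g.[p.1%:P].[p.2] = 0].

Definition word_mx t (A B : 'M[R]_t) w : 'M[R]_t :=
  \big[mulmx/1%:M]_(l <- w) (if l == lX then A else B).

Definition ntrace t (A : 'M[R]_t) : R := t%:R^-1 * \tr A.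

Definition pair_moment_mx t (A B : 'M[R]_t) : 'M[R]_7 :=
  moment_mx (fun w => ntrace (word_mx A B w)).

Definition atom := {t : nat & ('M[R]_t * 'M[R]_t)%type}.
Definition atom_size (a : atom) : nat := tag a.
Definition atom_moment (a : atom) w : R :=
  ntrace (word_mx (tagged a).1 (tagged a).2 w).
Definition atom_valid (a : atom) : Prop :=
  [/\ (0 < atom_size a)%N, (tagged a).1^T = (tagged a).1
    & (tagged a).2^T = (tagged a).2].

(* A finite atomic measure: a list of weighted, pairwise distinct atoms. *)
Definition measure := seq (R * atom).

Definition represents (mu : measure) beta : Prop :=
  [/\ uniq [seq p.2 | p <- mu],
      forall p, p \in mu -> 0 < p.1 /\ atom_valid p.2,
      \sum_(p <- mu) p.1 = 1
    & forall w, (size w <= 4)%N ->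
        beta w = \sum_(p <- mu) p.1 * atom_moment p.2 w].

(* The type (m_1, ..., m_r) is the list [:: m_1; ...; m_r], so that m_i is
   the entry of index i - 1. *)
Definition has_type (mu : measure) (m : seq nat) : Prop :=
  last 0%N m <> 0%N /\
  forall i, count (fun p => atom_size p.2 == i.+1) mu = nth 0%N m i.

Definition type_lt (m m' : seq nat) : Prop :=
  (size m < size m')%N \/
  (size m = size m' /\
   exists k, (nth 0 m k < nth 0 m' k)%N /\
     forall j, (k < j)%N -> nth 0%N m j = nth 0%N m' j).

Definition minimal_measure_of_type (mu : measure) (m : seq nat) beta : Prop :=
  [/\ represents mu beta, has_type mu m
    & forall mu' m', represents mu' beta -> has_type mu' m' ->
        ~ type_lt m' m].

Definition admits_nc_measure beta : Prop :=
  exists mu m, minimal_measure_of_type mu m beta /\ (1 < size m)%N.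

Definition mx22 (a b c d : R) : 'M[R]_2 :=
  \matrix_(i, j) if i == 0 then (if j == 0 then a else b)
                 else (if j == 0 then c else d).

(* The pair of 2 x 2 matrices (X, Y) attached to the parameters a1, a2. *)
Definition Xmat (a1 : R) : 'M[R]_2 :=
  mx22 (Num.sqrt a1) 0 0 (- Num.sqrt a1).

Definition Ymat (a1 a2 : R) : 'M[R]_2 :=
  let a := a2 / Num.sqrt (a1 * (1 - a1)) in
  let b := 1 / 2 * Num.sqrt (4 - a ^+ 2) in
  Num.sqrt (1 - a1) *: mx22 (a / 2) b b (- (a / 2)).

End TracialMoments.

(* Main.v *)
(* A pair (X, Y) with X^2 + Y^2 = 1 has central elements u = X^2 - Y^2 and v
   = XY + YX, and -(XY - YX)^2 = 1 - u^2 - v^2. So its irreducible summands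
   are points of the circle and 2 x 2 pairs, the latter parametrized by the
   points (u, v) of the open unit disc and having vanishing odd moments.
   Splitting every atom of a measure along the kernel of the commutator, and
   replacing the 2 x 2 part by a multiple of the atom at its mean point of
   the disc, leaves a positive remainder supported on the circle; this gives
   case (2). Conversely a positive commutative moment matrix on the circle is
   a positive Toeplitz matrix of size 5, which is a sum of point masses by
   Caratheodory's theorem. When the odd moments vanish, the sequence amounts
   to the moments of degree at most 2 of a measure on the disc, which can be
   carried by one interior point and the two end points of a chord; an end
   point of the chord is the image of an antipodal pair on the circle, whence
   the type (4,1). *)
Require Import Defs.
From mathcomp Require Import all_boot all_order all_algebra.
From mathcomp Require Import boolp classical_sets functions cardinality reals.
From mathcomp Require Import complex ring lra zify.

Set Implicit Arguments.
Unset Strict Implicit.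
Unset Printing Implicit Defensive.

Import Order.TTheory GRing.Theory Num.Theory.
Local Open Scope classical_set_scope.
Local Open Scope ring_scope.

(** * Positive Toeplitz matrices *)

Local Open Scope sesquilinear_scope.

(** In the coordinates 1, u, v, C = XY - YX, X, Y, the commutator coordinate decouples from the
    others in the moment form, with coefficient twice the gap between the moments of XXYY and XYXY.
    A multiple xi of the atom at (p, q) leaves a commutative remainder only if it uses up this
    coefficient, so xi (1 - p^2 - q^2) is forced. Minimality of xi follows by convexity: for 0 < eta
    < xi, the difference at eta is a convex combination of [M2] and the difference at xi with
    positive weight on [M2]. The mean point is a good choice because nonnegative variances yield
    both p^2 + q^2 < 1 and the bound of xi by the mass of the 2 x 2 part. Atoms are never decomposed
    into irreducibles. C anticommutes with X and Y, so C^2 commutes with both, a polynomial in C^2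
    projects onto the kernel of C, and the odd traces off that kernel cancel in pairs. Any
    representing measure suffices in the end: a minimal type exists by well-foundedness, and atoms
    of size 1 alone would make the sequence commutative. *)

Lemma quadratic_nonneg_linear_coef_eq0 (F : numFieldType) (d e : F) :
  0 <= d -> 0 <= e -> (forall t, 0 <= t -> 0 <= t ^+ 2 * d - 2 * t * e) ->
  e = 0.
Proof.
(* The minimizer [e / d] is replaced by [e / (d + 1)], which needs no separate case [d = 0]. *)
move=> d0 e0 /(_ (e / (d + 1))).
have d1 : 0 < d + 1 by apply: ltr_wpDl.
rewrite divr_ge0 ?(ltW d1)// => /(_ isT).
have -> : (e / (d + 1)) ^+ 2 * d - 2 * (e / (d + 1)) * e
    = - (e ^+ 2 * (d + 2) / (d + 1) ^+ 2) by field; rewrite gt_eqF.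
rewrite oppr_ge0 pmulr_lle0 ?invr_gt0 ?exprn_gt0//.
have d2 : 0 < d + 2 by apply: ltr_wpDl.
rewrite pmulr_lle0// => h.
by apply/eqP; rewrite -sqrf_eq0 eq_le h exprn_ge0.
Qed.

Lemma mulmx_trmxC_eq0 (C : numClosedFieldType) n (u : 'rV[C]_n) :
  (u *m u ^t*) 0 0 = 0 -> u = 0.
Proof.
rewrite mxE => /eqP; rewrite psumr_eq0; last first.
  by move=> i _; rewrite !mxE -normCK exprn_ge0.
move=> /allP h; apply/rowP => i; rewrite mxE.
have := h i; rewrite mem_index_enum => /(_ isT); rewrite !mxE -normCK.
by rewrite sqrf_eq0 normr_eq0 => /eqP.
Qed.

Definition hform (C : numClosedFieldType) n (T : 'M[C]_n) (u v : 'rV[C]_n) : C :=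
  (u *m T *m v ^t*) 0 0.

Definition hpsd (C : numClosedFieldType) n (T : 'M[C]_n) : Prop :=
  T ^t* = T /\ forall u, 0 <= hform T u u.

Lemma trmxC_mul (C : numClosedFieldType) m n p (A : 'M[C]_(m, n))
  (B : 'M[C]_(n, p)) : (A *m B) ^t* = B ^t* *m A ^t*.
Proof. by rewrite trmx_mul map_mxM. Qed.

Lemma trmxCZ (C : numClosedFieldType) m n (a : C) (A : 'M[C]_(m, n)) :
  (a *: A) ^t* = a^* *: A ^t*.
Proof. by rewrite linearZ /= map_mxZ. Qed.

Lemma trmxCB (C : numClosedFieldType) m n (A B : 'M[C]_(m, n)) :
  (A - B) ^t* = A ^t* - B ^t*.
Proof. by rewrite linearB /= map_mxB. Qed.

Lemma hformC (C : numClosedFieldType) n (T : 'M[C]_n) (u v : 'rV[C]_n) :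
  T ^t* = T -> hform T v u = (hform T u v)^*.
Proof.
move=> hT; rewrite /hform.
have -> : v *m T *m u ^t* = (u *m T *m v ^t*) ^t*.
  by rewrite !trmxC_mul trmxCK hT mulmxA.
by rewrite !mxE.
Qed.

Lemma hform_subZ (C : numClosedFieldType) n (T : 'M[C]_n) (u v : 'rV[C]_n)
    (a : C) :
  hform T (u - a *: v) (u - a *: v) =
  hform T u u - a^* * hform T u v - a * hform T v u
  + a * a^* * hform T v v.
Proof.
rewrite /hform trmxCB trmxCZ !(mulmxBl, mulmxBr) -!scalemxAl -!scalemxAr.
move: (u *m T *m u ^t*) (u *m T *m v ^t*) (v *m T *m u ^t*) (v *m T *m v ^t*).
by move=> U V W Z; rewrite !mxE; ring.
Qed.

(** At [v - t *: u] with [u = v *m T], the form has no constant term, and its linear term in t is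
    minus twice the squared length of [u]. *)
Lemma hpsd_ker (C : numClosedFieldType) n (T : 'M[C]_n) (v : 'rV[C]_n) :
  hpsd T -> hform T v v = 0 -> v *m T = 0.
Proof.
move=> [hT pT] v0; set u := v *m T.
have uu : hform T v u = (u *m u ^t*) 0 0 by [].
have u0 : 0 <= (u *m u ^t*) 0 0.
  by rewrite mxE sumr_ge0// => i _; rewrite !mxE -normCK exprn_ge0.
apply: mulmx_trmxC_eq0.
apply: (quadratic_nonneg_linear_coef_eq0 (pT u)) => // t t0.
have := pT (v - t *: u); rewrite hform_subZ v0 (hformC v u) // uu.
rewrite (geC0_conj u0) (geC0_conj t0).
by congr (_ <= _); ring.
Qed.

Definition node (C : numClosedFieldType) n (a : C) : 'cV[C]_n := \col_i a ^+ i.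

(** Constancy along diagonals is not built in: it is the separate hypothesis
    [tau i.+1 j.+1 = tau i j], checked again after each deflation. *)
Definition toeplitz (C : numClosedFieldType) n (tau : nat -> nat -> C) :
  'M[C]_n := \matrix_(i, j) tau i j.

Lemma mul_node (C : numClosedFieldType) n (v : 'rV[C]_n) (a : C) :
  (v *m node n a) 0 0 = (rVpoly v).[a].
Proof.
rewrite (horner_coef_wide _ (size_poly _ _)) mxE.
apply: eq_bigr => i _; rewrite mxE coef_rVpoly.
by case: insubP => [j _ /val_inj -> | /negP []] //=.
Qed.

(** With row vectors read as polynomials, multiplication by z is an isometry of a Toeplitz form. The
    size bounds ensure that no coefficient is pushed out of the matrix. *)
Lemma hform_shift (C : numClosedFieldType) n (tau : nat -> nat -> C)
    (f g : {poly C}) :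
  (forall i j, tau i.+1 j.+1 = tau i j) ->
  (size f <= n)%N -> (size g <= n)%N ->
  hform (toeplitz n.+1 tau) (poly_rV (f * 'X)) (poly_rV (g * 'X)) =
  hform (toeplitz n.+1 tau) (poly_rV f) (poly_rV g).
Proof.
move=> htau sf sg.
have E (f1 g1 : {poly C}) :
  hform (toeplitz n.+1 tau) (poly_rV f1) (poly_rV g1) =
  \sum_(j < n.+1) \sum_(i < n.+1) f1`_i * tau i j * (g1`_j)^*.
  rewrite /hform mxE; apply: eq_bigr => j _.
  rewrite !mxE mulr_suml; apply: eq_bigr => i _; by rewrite !mxE.
rewrite !E big_ord_recl [RHS]big_ord_recr /=.
rewrite [X in X + _]big1 => [|i _]; last by rewrite (coefMX g) /= conjC0 mulr0.
rewrite [X in _ = _ + X]big1 => [|i _]; last first.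
  by rewrite [g`_n]nth_default// conjC0 mulr0.
rewrite add0r addr0; apply: eq_bigr => j _.
rewrite big_ord_recl [RHS]big_ord_recr /= (coefMX f 0) /= !mul0r add0r.
rewrite [f`_n]nth_default// !mul0r addr0.
by apply: eq_bigr => i _; rewrite !coefMX /= htau.
Qed.

Lemma toeplitz_ker_shift (C : numClosedFieldType) n (tau : nat -> nat -> C)
    (f : {poly C}) :
  (forall i j, tau i.+1 j.+1 = tau i j) -> hpsd (toeplitz n.+1 tau) ->
  (size f <= n)%N -> poly_rV f *m toeplitz n.+1 tau = 0 ->
  poly_rV (f * 'X) *m toeplitz n.+1 tau = 0.
Proof.
move=> htau pT sf f0; apply: (hpsd_ker pT); rewrite hform_shift//.
by rewrite /hform f0 mul0mx mxE.
Qed.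

Lemma toeplitz_ker_shiftn (C : numClosedFieldType) n (tau : nat -> nat -> C)
    (f : {poly C}) k :
  (forall i j, tau i.+1 j.+1 = tau i j) -> hpsd (toeplitz n.+1 tau) ->
  (size f + k <= n.+1)%N -> poly_rV f *m toeplitz n.+1 tau = 0 ->
  poly_rV (f * 'X^k) *m toeplitz n.+1 tau = 0.
Proof.
move=> htau pT + f0; elim: k => [|k IH] sf; first by rewrite expr0 mulr1.
rewrite exprSr mulrA; apply: toeplitz_ker_shift => //; last first.
  by apply: IH; rewrite (leq_trans _ sf)// leq_add2l.
have [->|fn0] := eqVneq f 0; first by rewrite mul0r size_poly0.
by rewrite size_mulXn// addnC -ltnS -addnS.
Qed.

(* The kernel consists of the multiples of its element h of least degree.  Write
   h = (z - a) k.  Then zk = ak modulo the kernel, while k and zk have the same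
   nonzero length, so |a| = 1. *)
Lemma toeplitz_ker_common_root (C : numClosedFieldType) n
    (tau : nat -> nat -> C) :
  (forall i j, tau i.+1 j.+1 = tau i j) -> hpsd (toeplitz n.+1 tau) ->
  toeplitz n.+1 tau != 0 ->
  exists2 a : C, `|a| = 1 &
    forall v : 'rV[C]_n.+1, v *m toeplitz n.+1 tau = 0 -> (v *m node n.+1 a) 0 0 = 0.
Proof.
move=> htau pT; set T := toeplitz _ _ => Tn0.
have [kz|] := pselect (forall v : 'rV_n.+1, v *m T = 0 -> v = 0).
  by exists 1; [exact: normr1 | move=> v /kz ->; rewrite mul0mx mxE].
move=> /existsNP[v0 /not_implyP[v0T /eqP v0n0]].
pose P m := `[< exists v : 'rV_n.+1,
  [/\ v != 0, v *m T = 0 & size (rVpoly v) = m] >].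
have exP : exists m, P m by exists (size (rVpoly v0)); apply/asboolP; exists v0.
case: (ex_minnP exP) => s /asboolP[v [vn0 vT sv]] smin.
set h := rVpoly v in sv.
have hn0 : h != 0.
  by apply: contraNneq vn0 => h0; rewrite -(rVpolyK v) -/h h0 linear0.
have hv : poly_rV h = v by rewrite /h rVpolyK.
have sh : (size h <= n.+1)%N by exact: size_poly.
have s0 : (0 < s)%N by rewrite -sv size_poly_gt0.
have small (f : {poly C}) : (size f < s)%N -> poly_rV f *m T = 0 -> f = 0.
  move=> sf fT; apply/eqP; apply: contraTT (sf) => fn0; rewrite -leqNgt.
  have fK : rVpoly (poly_rV f : 'rV_n.+1) = f.
    by rewrite poly_rV_K// (leq_trans (ltnW sf))// -sv.
  apply: smin; apply/asboolP; exists (poly_rV f); split; rewrite ?fK//.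
  by apply: contraNneq fn0 => f0; rewrite -fK f0 linear0.
(* A constant in the kernel would bring in every power of z, making T zero. *)
have sh1 : size h != 1%N.
  apply: contraNneq Tn0 => sh1; apply/eqP/row_matrixP => i; rewrite row0.
  have /eqP/size_poly1P[c cn0 hc] := sh1.
  have : poly_rV (h * 'X^i) *m T = 0.
    by apply: toeplitz_ker_shiftn; rewrite ?hv// sh1 add1n ltn_ord.
  rewrite hc mul_polyC linearZ /= -scalemxAl => /eqP.
  rewrite scaler_eq0 (negbTE cn0) /= => /eqP <-.
  rewrite rowE; congr (_ *m _); apply/rowP => j.
  by rewrite !mxE coefXn.
have /closed_rootP[a ra] := sh1.
have [k hk] := factor_theorem _ _ ra.
have kn0 : k != 0 by apply: contraNneq hn0 => k0; rewrite hk k0 mul0r.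
have sk : size h = (size k).+1 by rewrite hk size_Mmonic ?monicXsubC// size_XsubC addn2.
have skn : (size k <= n)%N by rewrite -ltnS -sk.
have kT : poly_rV k *m T != 0.
  apply: contraNneq kn0 => kT; apply/eqP/small => //.
  by rewrite -sv sk.
have kk0 : hform T (poly_rV k) (poly_rV k) != 0.
  by apply: contraNneq kT => /hpsd_ker -> //.
have a1 : `|a| = 1.
  have eT : poly_rV (k * 'X) *m T = a *: (poly_rV k *m T).
    apply/eqP; rewrite -subr_eq0 scalemxAl -mulmxBl -linearZ -linearB /=.
    have -> : k * 'X - a *: k = h by rewrite hk -mul_polyC mulrBr (mulrC k a%:P).
    by rewrite hv vT.
  have := hform_shift htau skn skn; rewrite -/T.
  have hX w : hform T (poly_rV (k * 'X)) w = a * hform T (poly_rV k) w.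
    by rewrite /hform eT -scalemxAl !mxE.
  have hT : T ^t* = T by case: pT.
  rewrite hX (hformC (poly_rV (k * 'X)) (poly_rV k))// hX rmorphM /= -hformC//.
  rewrite mulrA -normCK -[RHS]mul1r => /(mulIf kk0) /eqP.
  by rewrite sqrp_eq1 ?normr_ge0// => /eqP.
exists a => // w wT; rewrite mul_node.
have : poly_rV (rVpoly w) *m T = 0 by rewrite rVpolyK.
have : (size (rVpoly w) <= n.+1)%N by exact: size_poly.
move: (rVpoly w) => f; have [m] := ubnP (size f).
elim: m f => // m IH f sfm sfn fT.
have [->|fn0] := eqVneq f 0; first by rewrite horner0.
have shf : (size h <= size f)%N.
  by rewrite leqNgt; apply: contraNN fn0 => sfh; apply/eqP/small; rewrite -?sv.
(* Division by h inside the kernel: the subtracted multiple of h vanishes at a and cancels the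
   leading term of f. *)
pose c := lead_coef f / lead_coef h.
pose g := h * 'X^(size f - size h).
have gT : poly_rV g *m T = 0.
  by apply: toeplitz_ker_shiftn; rewrite ?hv// subnKC.
have sg : size g = size f by rewrite size_mulXn// subnK.
have lg : lead_coef g = lead_coef h by rewrite lead_coef_Mmonic ?monicXn.
have ga : g.[a] = 0 by rewrite hornerM (rootP ra) mul0r.
have sfg : (size (f - c *: g)%R < size f)%N.
  have f0 : (0 < size f)%N by rewrite size_poly_gt0.
  rewrite -[X in (_ < X)%N](prednK f0) ltnS; apply/leq_sizeP => j.
  rewrite leq_eqVlt => /orP[/eqP <-|jf].
    rewrite coefB coefZ -lead_coefE -sg -lead_coefE lg.
    by rewrite /c divfK ?lead_coef_eq0// subrr.
  rewrite coefB coefZ !nth_default ?mulr0 ?subrr// ?sg;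
  by rewrite -(prednK f0).
have : (f - c *: g).[a] = 0.
  apply: IH.
  - by rewrite (leq_trans sfg).
  - by rewrite (leq_trans (ltnW sfg)).
  - by rewrite linearB linearZ /= mulmxBl -scalemxAl fT gT scaler0 subrr.
by rewrite hornerD hornerN hornerZ ga mulr0 subr0.
Qed.

Lemma mxrank_le_ker (F : fieldType) m n p (A : 'M[F]_(m, n)) (B : 'M[F]_(m, p)) :
  (forall v : 'rV_m, v *m A = 0 -> v *m B = 0) -> (\rank B <= \rank A)%N.
Proof.
move=> h; have : (kermx A <= kermx B)%MS.
  apply/row_subP => i; apply/sub_kermxP/h.
  by rewrite -row_mul mulmx_ker row0.
move=> /mxrankS; rewrite !mxrank_ker => /(leq_sub2l m).
by rewrite !subKn ?rank_leq_row.
Qed.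

Lemma mxrank_lt_ker (F : fieldType) m n p (A : 'M[F]_(m, n)) (B : 'M[F]_(m, p))
    (w : 'rV_m) :
  (forall v : 'rV_m, v *m A = 0 -> v *m B = 0) -> w *m A != 0 -> w *m B = 0 ->
  (\rank B < \rank A)%N.
Proof.
move=> h wA wB; have : (kermx A < kermx B)%MS.
  rewrite ltmxE; apply/andP; split.
    apply/row_subP => i; apply/sub_kermxP/h.
    by rewrite -row_mul mulmx_ker row0.
  apply: contra wA => BA; apply/eqP/sub_kermxP; apply: submx_trans BA.
  exact/sub_kermxP.
move=> /rank_ltmx; rewrite !mxrank_ker.
by have := rank_leq_row A; have := rank_leq_row B; lia.
Qed.

(** The Fredholm alternative: hermitian symmetry turns the cokernel of T into its left kernel. *)
Lemma hermitian_col_in_range (C : numClosedFieldType) n (T : 'M[C]_n)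
    (e : 'cV[C]_n) :
  T ^t* = T -> (forall v : 'rV[C]_n, v *m T = 0 -> (v *m e) 0 0 = 0) ->
  exists y : 'rV[C]_n, y *m T = e ^t*.
Proof.
move=> hT he; exists (e ^t* *m pinvmx T); apply: mulmxKpV.
rewrite submxE -[_ *m _]trmxCK trmxC_mul trmxCK.
suff -> : (cokermx T) ^t* *m e = 0 by rewrite trmx0 map_mx0.
apply/row_matrixP => i; rewrite row_mul row0; apply/rowP => j.
rewrite (ord1 j) [RHS]mxE; apply: he.
by rewrite -row_mul -{2}hT -trmxC_mul mulmx_coker trmx0 map_mx0 row0.
Qed.

Lemma outer_entry (C : numClosedFieldType) n (e : 'cV[C]_n) (u v : 'rV[C]_n) :
  (u *m (e *m e ^t*) *m v ^t*) 0 0 = (u *m e) 0 0 * ((v *m e) 0 0)^*.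
Proof.
rewrite mulmxA -(mulmxA _ (e ^t*)) -trmxC_mul mxE big_ord1.
by congr (_ * _); rewrite !mxE.
Qed.

(* Subtracting from a positive form the largest admissible multiple of e e^*,
   where e = T y^*, lowers the rank. *)
Lemma hpsd_deflate (C : numClosedFieldType) n (T : 'M[C]_n) (e : 'cV[C]_n)
    (y : 'rV[C]_n) :
  hpsd T -> y *m T = e ^t* -> e != 0 ->
  let T' := T - (hform T y y)^-1 *: (e *m e ^t*) in
  [/\ 0 < hform T y y, hpsd T', y *m T' = 0, (y *m e) 0 0 != 0
    & (\rank T' < \rank T)%N].
Proof.
move=> pT yT en0; have [hT pT'] := pT.
have e0 : e ^t* != 0.
  by apply: contraNneq en0 => e0; rewrite -(trmxCK e) e0 trmx0 map_mx0.
have Dn0 : hform T y y != 0.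
  by apply: contraNneq e0 => /hpsd_ker; rewrite yT => ->.
have D0 : 0 < hform T y y by rewrite lt0r Dn0 pT'.
have uyE u : hform T u y = (u *m e) 0 0.
  by rewrite /hform -mulmxA -{1}hT -trmxC_mul yT trmxCK.
move=> T'; have T'E u v : hform T' u v =
    hform T u v - (hform T y y)^-1 * hform T u y * (hform T v y)^*.
  rewrite -mulrA (uyE u) (uyE v) /T'; move: (hform T y y) => D.
  rewrite /hform mulmxBr mulmxBl -scalemxAr -scalemxAl.
  rewrite -outer_entry; move: (u *m T *m _) (u *m (e *m _) *m _) => U V.
  by rewrite !mxE.
have yT' : y *m T' = 0.
  rewrite mulmxBr -scalemxAr mulmxA [y *m e]mx11_scalar -uyE mul_scalar_mx.
  by rewrite scalerA mulVf// scale1r yT subrr.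
split=> //; first split.
- rewrite trmxCB trmxCZ trmxC_mul trmxCK hT; congr (_ - _ *: _).
  by rewrite fmorphV /= (geC0_conj (pT' y)).
- move=> u; rewrite T'E.
  (* The deflated form at u is the original one at the component of u orthogonal to y. *)
  have := pT' (u - (hform T u y / hform T y y) *: y).
  rewrite hform_subZ (hformC u y)// rmorphM fmorphV /= (geC0_conj (pT' y)).
  by congr (_ <= _); field.
- by rewrite -uyE.
- apply: (mxrank_lt_ker (w := y)) => //; last by rewrite yT.
  move=> v vT; have ve : v *m e = 0.
    by apply/rowP => i; rewrite (ord1 i) -uyE /hform vT mul0mx.
  by rewrite mulmxBr -scalemxAr mulmxA ve mul0mx scaler0 vT subrr.
Qed.

(** Induction on the rank. A common root a of the kernel puts its node in the range, so the node can
    be deflated, and [|a| = 1] keeps the remainder Toeplitz. *)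
Lemma caratheodory_toeplitz (C : numClosedFieldType) n
    (tau : nat -> nat -> C) :
  (forall i j, tau i.+1 j.+1 = tau i j) -> hpsd (toeplitz n.+1 tau) ->
  exists s : seq (C * C),
    [/\ uniq [seq p.2 | p <- s],
        forall p, p \in s -> 0 < p.1 /\ `|p.2| = 1
      & toeplitz n.+1 tau =
        \sum_(p <- s) p.1 *: (node n.+1 p.2 *m (node n.+1 p.2) ^t*)].
Proof.
have [r] := ubnP (\rank (toeplitz n.+1 tau)).
elim: r tau => // r IH tau rk htau pT.
have [T0|Tn0] := eqVneq (toeplitz n.+1 tau) 0.
  by exists [::]; split=> //; rewrite big_nil.
have [a a1 ha] := toeplitz_ker_common_root htau pT Tn0.
set e := node n.+1 a in ha.
have [y yT] := hermitian_col_in_range pT.1 ha.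
have en0 : e != 0.
  apply/eqP => /colP /(_ 0); rewrite !mxE expr0 => /eqP.
  by rewrite oner_eq0.
have [D0 pT' yT' ye rk'] := hpsd_deflate pT yT en0.
set D := hform _ y y in D0 pT' yT' rk'.
pose tau' i j := tau i j - D^-1 * (a ^+ i * (a ^+ j)^*).
have T'E : toeplitz n.+1 tau' = toeplitz n.+1 tau - D^-1 *: (e *m e ^t*).
  by apply/matrixP => i j; rewrite !mxE big_ord1 !mxE.
have htau' i j : tau' i.+1 j.+1 = tau' i j.
  rewrite /tau' htau !exprS rmorphM /=; congr (_ - _ * _).
  by rewrite mulrACA -normCK a1 expr1n mul1r.
rewrite -T'E in pT' yT' rk'.
have [s [us hs Ts]] := IH tau' (leq_trans rk' rk) htau' pT'.
exists ((D^-1, a) :: s); split.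
(* The deflated form vanishes at y, so y is orthogonal to every node of s; it is not orthogonal to
   the node of a, which is therefore new. *)
- rewrite /= us andbT; apply/negP => /mapP[p ps ap].
  have yp : (y *m node n.+1 p.2) 0 0 != 0 by rewrite -ap.
  have : hform (toeplitz n.+1 tau') y y = 0 by rewrite /hform yT' mul0mx mxE.
  have -> : hform (toeplitz n.+1 tau') y y =
      \sum_(q <- s) q.1 * `|(y *m node n.+1 q.2) 0 0| ^+ 2.
    rewrite /hform Ts mulmx_sumr mulmx_suml summxE; apply: eq_bigr => q _.
    by rewrite -scalemxAr -scalemxAl mxE outer_entry normCK.
  move=> /eqP; rewrite big_seq psumr_eq0; last first.
    by move=> q /hs[q0 _]; rewrite mulr_ge0 ?exprn_ge0// ltW.
  move=> /allP /(_ p ps); rewrite ps /= mulf_eq0 gt_eqF ?(hs p ps).1//=.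
  by rewrite sqrf_eq0 normr_eq0 (negbTE yp).
- move=> p; rewrite inE => /predU1P[->|/hs//].
  by rewrite invr_gt0.
- by rewrite big_cons -Ts T'E /= addrC subrK.
Qed.
Local Close Scope sesquilinear_scope.

(** * Sequences satisfying Y^2 = 1 - X^2 *)

Definition circle_seq (R : realType) (g : word -> R) : Prop :=
  tracial_seq g /\ forall w, (size w <= 2)%N ->
    g (w ++ [:: lY; lY]) = g w - g (w ++ [:: lX; lX]).

(** Rewriting rules towards ten free values, at the words 1, X, Y, XX, XY, XXX, XXY, XXXX, XXXY and
    XYXY. *)
Lemma circle_words (R : realType) (g : word -> R) : circle_seq g ->
  ((g [:: lY; lX] = g [:: lX; lY]) *
   (g [:: lY; lY] = g [::] - g [:: lX; lX]) *
   (g [:: lX; lY; lX] = g [:: lX; lX; lY]) *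
   (g [:: lY; lX; lX] = g [:: lX; lX; lY]) *
   (g [:: lX; lY; lY] = g [:: lX] - g [:: lX; lX; lX]) *
   (g [:: lY; lX; lY] = g [:: lX] - g [:: lX; lX; lX]) *
   (g [:: lY; lY; lX] = g [:: lX] - g [:: lX; lX; lX]) *
   (g [:: lY; lY; lY] = g [:: lY] - g [:: lX; lX; lY]) *
   (g [:: lX; lX; lY; lX] = g [:: lX; lX; lX; lY]) *
   (g [:: lX; lY; lX; lX] = g [:: lX; lX; lX; lY]) *
   (g [:: lY; lX; lX; lX] = g [:: lX; lX; lX; lY]) *
   (g [:: lX; lX; lY; lY] = g [:: lX; lX] - g [:: lX; lX; lX; lX]) *
   (g [:: lX; lY; lY; lX] = g [:: lX; lX] - g [:: lX; lX; lX; lX]) *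
   (g [:: lY; lY; lX; lX] = g [:: lX; lX] - g [:: lX; lX; lX; lX]) *
   (g [:: lY; lX; lX; lY] = g [:: lX; lX] - g [:: lX; lX; lX; lX]) *
   (g [:: lY; lX; lY; lX] = g [:: lX; lY; lX; lY]) *
   (g [:: lX; lY; lY; lY] = g [:: lX; lY] - g [:: lX; lX; lX; lY]) *
   (g [:: lY; lX; lY; lY] = g [:: lX; lY] - g [:: lX; lX; lX; lY]) *
   (g [:: lY; lY; lX; lY] = g [:: lX; lY] - g [:: lX; lX; lX; lY]) *
   (g [:: lY; lY; lY; lX] = g [:: lX; lY] - g [:: lX; lX; lX; lY]) *
   (g [:: lY; lY; lY; lY] =
      g [::] - g [:: lX; lX] - (g [:: lX; lX] - g [:: lX; lX; lX; lX])))%type.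
Proof.
move=> [[rt rv] cr].
have rot1 w : (size w <= 4)%N -> g w = g (rot 1 w) by move=> /rt ->.
have rot2 w : (size w <= 4)%N -> g w = g (rot 2 w) by move=> /rt ->.
have rot3 w : (size w <= 4)%N -> g w = g (rot 3 w) by move=> /rt ->.
have yx : g [:: lY; lX] = g [:: lX; lY] by rewrite rot1.
have yy : g [:: lY; lY] = g [::] - g [:: lX; lX] by rewrite (cr [::]).
have xyy := cr [:: lX] isT; have yyy := cr [:: lY] isT.
have xxyy := cr [:: lX; lX] isT; have xyyy := cr [:: lX; lY] isT.
have yyyy := cr [:: lY; lY] isT; rewrite /= in xyy yyy xxyy xyyy yyyy.
have xyx : g [:: lX; lY; lX] = g [:: lX; lX; lY] by rewrite rot2.
have yxx : g [:: lY; lX; lX] = g [:: lX; lX; lY] by rewrite rot1.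
have xxxy : g [:: lX; lY; lX; lX] = g [:: lX; lX; lX; lY] by rewrite rot2.
rewrite xxxy in xyyy; rewrite yxx in yyy.
have yyxx : g [:: lY; lY; lX; lX] = g [:: lX; lX] - g [:: lX; lX; lX; lX].
  by rewrite (rot2 [:: lY; lY; lX; lX]).
rewrite yy yyxx in yyyy.
do !split=> //; by [rewrite rot1 | rewrite rot2 | rewrite rot3].
Qed.

Lemma circle_seq_ext (R : realType) (g h : word -> R) :
  circle_seq g -> circle_seq h ->
  g [::] = h [::] -> g [:: lX] = h [:: lX] -> g [:: lY] = h [:: lY] ->
  g [:: lX; lX] = h [:: lX; lX] -> g [:: lX; lY] = h [:: lX; lY] ->
  g [:: lX; lX; lX] = h [:: lX; lX; lX] ->
  g [:: lX; lX; lY] = h [:: lX; lX; lY] ->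
  g [:: lX; lX; lX; lX] = h [:: lX; lX; lX; lX] ->
  g [:: lX; lX; lX; lY] = h [:: lX; lX; lX; lY] ->
  g [:: lX; lY; lX; lY] = h [:: lX; lY; lX; lY] ->
  forall w, (size w <= 4)%N -> g w = h w.
Proof.
move=> cg ch e0 e1 e2 e3 e4 e5 e6 e7 e8 e9.
case=> [|[] [|[] [|[] [|[] [|? ?]]]]] //= _;
by rewrite ?(circle_words cg) ?(circle_words ch) ?e0 ?e1 ?e2 ?e3 ?e4 ?e5 ?e6
  ?e7 ?e8 ?e9.
Qed.

Lemma circle_seqD (R : realType) (g h : word -> R) (a b : R) :
  circle_seq g -> circle_seq h -> circle_seq (fun w => a * g w + b * h w).
Proof.
move=> [[gt gv] gc] [[ht hv] hc]; split; first split.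
- by move=> w k sw; rewrite gt// ht.
- by move=> w sw; rewrite gv// hv.
- by move=> w sw; rewrite gc// hc//; ring.
Qed.

Lemma basis_rev (w : word) : (size w <= 2)%N ->
  exists i : 'I_7, w = rev (tnth basis i).
Proof.
case: w => [|a [|b [|? ?]]] // _.
- by exists (@Ordinal 7 0 isT).
- by case: a; [exists (@Ordinal 7 2 isT) | exists (@Ordinal 7 1 isT)].
- by case: a; case: b; [exists (@Ordinal 7 6 isT) | exists (@Ordinal 7 4 isT)
    | exists (@Ordinal 7 5 isT) | exists (@Ordinal 7 3 isT)].
Qed.

Lemma basis_split (w : word) : (size w <= 4)%N ->
  exists i j : 'I_7, w = rev (tnth basis i) ++ tnth basis j.
Proof.
move=> sw.
have [i hi] : exists i : 'I_7, take 2 w = rev (tnth basis i).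
  by apply: basis_rev; rewrite size_take; case: ltnP.
have [j hj] : exists j : 'I_7, rev (drop 2 w) = rev (tnth basis j).
  by apply: basis_rev; rewrite size_rev size_drop leq_subLR.
by exists i, j; rewrite -hi -(can_inj revK hj) cat_take_drop.
Qed.

Lemma basis_word_size (i : 'I_7) : (size (tnth basis i) <= 2)%N.
Proof. by case: i => [[|[|[|[|[|[|[|]]]]]]] ?]. Qed.

Lemma moment_mx_eqP (R : realType) (g h : word -> R) :
  moment_mx g = moment_mx h <->
  forall w, (size w <= 4)%N -> g w = h w.
Proof.
split=> [/matrixP gh w /basis_split[i [j ->]]|gh].
  by have := gh i j; rewrite !mxE.
apply/matrixP => i j; rewrite !mxE gh// size_cat size_rev.
by rewrite (leq_add (basis_word_size i) (basis_word_size j)).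
Qed.

Lemma mcolE (R : realType) (g : word -> R) (w : word) (i : 'I_7) :
  w \in tval basis ->
  mcol (moment_mx g) w i 0 = g (rev (tnth basis i) ++ w).
Proof.
move=> wb; rewrite !mxE; congr (g (_ ++ _)).
rewrite (tnth_nth [::]) inordK ?nth_index//.
by have := wb; rewrite -index_mem.
Qed.

Lemma circle_seq_of_rel (R : realType) (g : word -> R) : tracial_seq g ->
  mcol (moment_mx g) [:: lY; lY] =
  mcol (moment_mx g) [::] - mcol (moment_mx g) [:: lX; lX] -> circle_seq g.
Proof.
move=> tg /colP h; split=> // w /basis_rev[i ->].
have := h i; rewrite [in RHS]mxE [X in _ + X]mxE !mcolE//.
by rewrite cats0.
Qed.

(* The quadratic form of the moment matrix at
   b0 + b1 (X^2 - Y^2) + b2 (XY + YX) + b3 (XY - YX) + b4 X + b5 Y. *)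
Definition cform (R : realType) (g : word -> R) (b0 b1 b2 b3 b4 b5 : R) : R :=
  let m := g [::] in let x := g [:: lX] in let y := g [:: lY] in
  let u := 2 * g [:: lX; lX] - m in let v := 2 * g [:: lX; lY] in
  let uu := 4 * g [:: lX; lX; lX; lX] - 4 * g [:: lX; lX] + m in
  let uv := 4 * g [:: lX; lX; lX; lY] - 2 * g [:: lX; lY] in
  let vv := 2 * g [:: lX; lY; lX; lY]
            + 2 * (g [:: lX; lX] - g [:: lX; lX; lX; lX]) in
  let xxx := g [:: lX; lX; lX] in let xxy := g [:: lX; lX; lY] in
  m * b0 ^+ 2 + uu * b1 ^+ 2 + vv * b2 ^+ 2
  + 2 * (u * b0 * b1 + v * b0 * b2 + uv * b1 * b2)
  + (m - uu - vv) * b3 ^+ 2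
  + (m + u) / 2 * b4 ^+ 2 + v * b4 * b5 + (m - u) / 2 * b5 ^+ 2
  + 2 * b0 * (x * b4 + y * b5)
  + 2 * b1 * ((2 * xxx - x) * b4 + (2 * xxy - y) * b5)
  + 2 * b2 * (2 * xxy * b4 + 2 * (x - xxx) * b5).

Definition o7 : nat -> 'I_7 := inord.

(** As X^2 + Y^2 = 1, the half-sum of the coefficients of X^2 and Y^2 joins the constant term, and
    only their half-difference remains as a coordinate. *)
Lemma moment_form (R : realType) (g : word -> R) (v : 'cV[R]_7) :
  circle_seq g ->
  (v^T *m moment_mx g *m v) 0 0 =
  cform g (v (o7 0) 0 + (v (o7 3) 0 + v (o7 6) 0) / 2)
    ((v (o7 3) 0 - v (o7 6) 0) / 2)
    ((v (o7 4) 0 + v (o7 5) 0) / 2) ((v (o7 4) 0 - v (o7 5) 0) / 2)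
    (v (o7 1) 0) (v (o7 2) 0).
Proof.
move=> cg.
have S (F : nat -> R) :
    \sum_(i < 7) F i = F 0 + F 1 + F 2 + F 3 + F 4 + F 5 + F 6.
  by rewrite !big_ord_recr big_ord0 /= add0r.
pose F i j := v (o7 i) 0 * v (o7 j) 0 *
  g (rev (nth [::] basis i) ++ nth [::] basis j).
have -> : (v^T *m moment_mx g *m v) 0 0 = \sum_(j < 7) \sum_(i < 7) F i j.
  rewrite mxE; apply: eq_bigr => j _; rewrite mxE mulr_suml.
  apply: eq_bigr => i _.
  by rewrite /F !mxE /o7 !inord_val !(tnth_nth [::]) mulrAC.
rewrite (S (fun j => \sum_(i < 7) F i j)) !(S (F^~ _)) /F /basis /= /rev /=.
by rewrite !(circle_words cg) /cform; field.
Qed.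

Lemma moment_mx_sym (R : realType) (g : word -> R) :
  tracial_seq g -> (moment_mx g)^T = moment_mx g.
Proof.
move=> [_ gv]; apply/matrixP => i j; rewrite !mxE.
rewrite -gv ?rev_cat ?revK// size_cat size_rev.
by rewrite (leq_add (basis_word_size _) (basis_word_size _)).
Qed.

(** A section of the change of coordinates in [moment_form], normalized by giving X^2 and Y^2
    opposite coefficients. *)
Definition form_vec (R : realType) (b0 b1 b2 b3 b4 b5 : R) : 'cV[R]_7 :=
  \col_i [:: b0; b4; b5; b1; b2 + b3; b2 - b3; - b1]`_i.

Lemma moment_form_vec (R : realType) (g : word -> R) (b0 b1 b2 b3 b4 b5 : R) :
  circle_seq g -> let v := form_vec b0 b1 b2 b3 b4 b5 in
  (v^T *m moment_mx g *m v) 0 0 = cform g b0 b1 b2 b3 b4 b5.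
Proof.
move=> cg v; rewrite moment_form//.
have E k : (k < 7)%N ->
    v (o7 k) 0 = [:: b0; b4; b5; b1; b2 + b3; b2 - b3; - b1]`_k.
  by move=> k7; rewrite mxE /o7 inordK.
rewrite !E //= subrr mul0r addr0.
have -> : (b1 - - b1) / 2 = b1 by lra.
have -> : (b2 + b3 + (b2 - b3)) / 2 = b2 by lra.
by have -> : (b2 + b3 - (b2 - b3)) / 2 = b3 by lra.
Qed.

Lemma psd_momentP (R : realType) (g : word -> R) : circle_seq g ->
  psdmx (moment_mx g) <->
  forall b0 b1 b2 b3 b4 b5, 0 <= cform g b0 b1 b2 b3 b4 b5.
Proof.
move=> cg; split=> [[_ h] b0 b1 b2 b3 b4 b5|h].
  by rewrite -moment_form_vec.
split; first exact: moment_mx_sym cg.1.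
by move=> v; rewrite moment_form.
Qed.

Lemma psdmx_ker (R : realType) n (A : 'M[R]_n) (v : 'cV[R]_n) :
  psdmx A -> (v^T *m A *m v) 0 0 = 0 -> A *m v = 0.
Proof.
move=> [sA pA] v0; set u := A *m v.
have uu (w : 'cV[R]_n) : (w^T *m w) 0 0 = \sum_i w i 0 ^+ 2.
  by rewrite mxE; apply: eq_bigr => i _; rewrite mxE expr2.
have u0 : 0 <= (u^T *m u) 0 0 by rewrite uu sumr_ge0// => i _; exact: sqr_ge0.
suff : (u^T *m u) 0 0 = 0.
  rewrite uu => /eqP; rewrite psumr_eq0; last by move=> i _; exact: sqr_ge0.
  move=> /allP h; apply/colP => i; rewrite [RHS]mxE.
  by have := h i; rewrite mem_index_enum sqrf_eq0 => /(_ isT) /eqP.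
apply: (quadratic_nonneg_linear_coef_eq0 (pA u)) => // t t0.
have := pA (v - t *: u).
have -> : (v - t *: u)^T *m A *m (v - t *: u) = v^T *m A *m v
    - t *: (u^T *m u) - t *: (u^T *m u) + t ^+ 2 *: (u^T *m A *m u).
  have vu : v^T *m A = u^T by rewrite /u trmx_mul sA.
  rewrite [(v - _)^T]linearB /= [(t *: u)^T]linearZ /= !(mulmxBl, mulmxBr) -!scalemxAl -!scalemxAr vu.
  rewrite -(mulmxA _ A v) -/u scalerA expr2 opprB !addrA.
  by rewrite addrAC.
move: (v^T *m A *m v) v0 (u^T *m u) (u^T *m A *m u) => W W0 U V.
by rewrite !mxE W0; congr (_ <= _); ring.
Qed.

(** * Traces of words cut by a commuting projection *)

Lemma word_mx_nil (R : realType) t (A B : 'M[R]_t) : word_mx A B [::] = 1%:M.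
Proof. by rewrite /word_mx big_nil. Qed.

Lemma word_mx_cons (R : realType) t (A B : 'M[R]_t) l w :
  word_mx A B (l :: w) = (if l == lX then A else B) *m word_mx A B w.
Proof. by rewrite /word_mx big_cons. Qed.

Lemma word_mx_cat (R : realType) t (A B : 'M[R]_t) w1 w2 :
  word_mx A B (w1 ++ w2) = word_mx A B w1 *m word_mx A B w2.
Proof.
elim: w1 => [|l w1 IH]; first by rewrite word_mx_nil mul1mx.
by rewrite /= !word_mx_cons IH mulmxA.
Qed.

Lemma word_mx_rev (R : realType) t (A B : 'M[R]_t) w :
  A^T = A -> B^T = B -> word_mx A B (rev w) = (word_mx A B w)^T.
Proof.
move=> sA sB; elim: w => [|l w IH]; first by rewrite word_mx_nil trmx1.
rewrite rev_cons -cats1 word_mx_cat IH !word_mx_cons word_mx_nil mulmx1.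
by rewrite trmx_mul; case: ifP; rewrite ?sA ?sB.
Qed.

Lemma word_mx_comm (R : realType) t (Q A B : 'M[R]_t) w :
  Q *m A = A *m Q -> Q *m B = B *m Q ->
  Q *m word_mx A B w = word_mx A B w *m Q.
Proof.
move=> QA QB; elim: w => [|l w IH]; first by rewrite word_mx_nil mulmx1 mul1mx.
rewrite !word_mx_cons mulmxA -[RHS]mulmxA -IH !mulmxA.
by case: ifP; rewrite ?QA ?QB.
Qed.

Lemma mxtrace_gram_ge0 (R : realType) m n (G : 'M[R]_(m, n)) :
  0 <= \tr (G^T *m G).
Proof.
rewrite /mxtrace sumr_ge0// => i _; rewrite mxE sumr_ge0// => j _.
by rewrite mxE -expr2 sqr_ge0.
Qed.

Lemma mxtrace_gram_eq0 (R : realType) m n (G : 'M[R]_(m, n)) :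
  \tr (G^T *m G) = 0 -> G = 0.
Proof.
move=> /eqP; rewrite psumr_eq0; last first.
  move=> i _; rewrite mxE sumr_ge0// => j _.
  by rewrite mxE -expr2 sqr_ge0.
move=> /allP h; apply/matrixP => i j; rewrite [RHS]mxE.
have := h j; rewrite mem_index_enum => /(_ isT) /=; rewrite mxE psumr_eq0.
  by move=> /allP /(_ i); rewrite mem_index_enum mxE mulf_eq0 orbb => /(_ isT)/eqP.
by move=> k _; rewrite mxE -expr2 sqr_ge0.
Qed.

(** For a projection Q commuting with A and B, the moments carried by the range of Q. The trace is
    still divided by t, so the cuts by Q and 1 - Q add up to the moments of the atom. *)
Definition cut_seq (R : realType) t (Q A B : 'M[R]_t) (w : word) : R :=
  ntrace (Q *m word_mx A B w).

Lemma atom_momentE (R : realType) t (A B : 'M[R]_t) w :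
  atom_moment (existT _ t (A, B)) w = cut_seq 1%:M A B w.
Proof. by rewrite /cut_seq mul1mx. Qed.

Lemma cut_seq_tracial (R : realType) t (Q A B : 'M[R]_t) :
  A^T = A -> B^T = B -> Q^T = Q -> Q *m A = A *m Q -> Q *m B = B *m Q ->
  tracial_seq (cut_seq Q A B).
Proof.
move=> sA sB sQ QA QB; split=> [w k _|w _]; rewrite /cut_seq /ntrace.
  rewrite -{2}(cat_take_drop k w) /rot !word_mx_cat !mulmxA.
  by rewrite (word_mx_comm _ QA QB) -mulmxA mxtrace_mulC.
rewrite word_mx_rev// -mxtrace_tr trmx_mul trmxK sQ.
by rewrite -(word_mx_comm _ QA QB).
Qed.

Lemma ntraceD (R : realType) t (A B : 'M[R]_t) :
  ntrace (A + B) = ntrace A + ntrace B.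
Proof. by rewrite /ntrace raddfD mulrDr. Qed.

Lemma ntraceZ (R : realType) t (a : R) (A : 'M[R]_t) :
  ntrace (a *: A) = a * ntrace A.
Proof. by rewrite /ntrace linearZ /= mulrCA. Qed.

Lemma cut_seq_circle (R : realType) t (Q A B : 'M[R]_t) :
  A^T = A -> B^T = B -> Q^T = Q -> Q *m A = A *m Q -> Q *m B = B *m Q ->
  A *m A + B *m B = 1%:M -> circle_seq (cut_seq Q A B).
Proof.
move=> sA sB sQ QA QB AB; split; first exact: cut_seq_tracial.
move=> w _; rewrite /cut_seq -mulN1r -ntraceZ -ntraceD; congr ntrace.
rewrite scaleN1r -mulmxBr; congr (_ *m _).
rewrite !word_mx_cat !word_mx_cons word_mx_nil /= !mulmx1.
by rewrite -[X in _ = X - _]mulmx1 -mulmxBr -AB addrC addKr.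
Qed.

Lemma cut_seq_psd (R : realType) t (Q A B : 'M[R]_t) :
  A^T = A -> B^T = B -> Q^T = Q -> Q *m A = A *m Q -> Q *m B = B *m Q ->
  Q *m Q = Q -> psdmx (moment_mx (cut_seq Q A B)).
Proof.
move=> sA sB sQ QA QB QQ; split; first exact/moment_mx_sym/cut_seq_tracial.
move=> v; pose W i := word_mx A B (tnth basis i).
pose G := \sum_i v i 0 *: (W i *m Q).
suff -> : (v^T *m moment_mx (cut_seq Q A B) *m v) 0 0 = ntrace (G^T *m G).
  by rewrite mulr_ge0 ?invr_ge0// mxtrace_gram_ge0.
have -> : G^T = \sum_i v i 0 *: (Q *m (W i)^T).
  rewrite /G raddf_sum; apply: eq_bigr => i _ /=.
  by rewrite linearZ /= trmx_mul sQ.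
rewrite mulmx_suml -[v^T *m _ *m v]mulmxA mxE.
rewrite [in RHS]/ntrace raddf_sum mulr_sumr; apply: eq_bigr => i _ /=.
rewrite mulmx_sumr raddf_sum !mxE !mulr_sumr; apply: eq_bigr => j _ /=.
rewrite -/(ntrace _) -scalemxAl -scalemxAr !ntraceZ !mxE.
congr (_ * _); rewrite mulrC; congr (_ * _).
rewrite /cut_seq word_mx_cat word_mx_rev// /ntrace; congr (_ * _).
by rewrite mulmxA [in RHS]mulmxA [RHS]mxtrace_mulC !mulmxA QQ.
Qed.

Definition atom1 (R : realType) (z : R * R) : atom R :=
  existT _ 1%N (z.1%:M, z.2%:M).

Lemma atom1_moment (R : realType) (z : R * R) w :
  atom_moment (atom1 z) w = \prod_(l <- w) (if l == lX then z.1 else z.2).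
Proof.
have E : word_mx (z.1%:M : 'M_1) z.2%:M w =
    (\prod_(l <- w) (if l == lX then z.1 else z.2))%:M.
  elim: w => [|l w IH]; first by rewrite word_mx_nil big_nil.
  by rewrite word_mx_cons IH big_cons scalar_mxM; case: ifP.
by rewrite /atom_moment /= E /ntrace invr1 mul1r mxtrace_scalar.
Qed.

Lemma atom1_valid (R : realType) (z : R * R) : atom_valid (atom1 z).
Proof. by split; rewrite //= tr_scalar_mx. Qed.

Lemma atom1_circle (R : realType) (z : R * R) :
  z.1 ^+ 2 + z.2 ^+ 2 = 1 -> circle_seq (atom_moment (atom1 z)).
Proof.
move=> hz; suff : circle_seq (cut_seq 1%:M (z.1%:M : 'M_1) z.2%:M).
  by congr circle_seq; apply/funext => w; rewrite -atom_momentE.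
apply: cut_seq_circle; rewrite ?tr_scalar_mx// ?mul1mx ?mulmx1//.
by rewrite -!scalar_mxM -raddfD /= -!expr2 hz.
Qed.

Lemma circle_seq_sum (R : realType) (I : eqType) (s : seq I) (c : I -> R)
    (f : I -> word -> R) :
  (forall i, i \in s -> circle_seq (f i)) ->
  circle_seq (fun w => \sum_(i <- s) c i * f i w).
Proof.
move=> h; split; first split.
- move=> w k sw; rewrite big_seq [RHS]big_seq; apply: eq_bigr => i /h[[ft _] _].
  by rewrite ft.
- move=> w sw; rewrite big_seq [RHS]big_seq; apply: eq_bigr => i /h[[_ ft] _].
  by rewrite ft.
- move=> w sw; rewrite -sumrB big_seq [RHS]big_seq.
  by apply: eq_bigr => i /h[_ fc]; rewrite fc// mulrBr.
Qed.

(** * Commutative sequences on the circle and trigonometric moments *)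

Local Open Scope complex_scope.

(* The moment of (X + iY)^k. *)
Definition circle_coef (R : realType) (g : word -> R) (k : nat) : R[i] :=
  [:: g [::] +i* 0; g [:: lX] +i* g [:: lY];
      (2 * g [:: lX; lX] - g [::]) +i* (2 * g [:: lX; lY]);
      (4 * g [:: lX; lX; lX] - 3 * g [:: lX]) +i*
        (4 * g [:: lX; lX; lY] - g [:: lY]);
      (8 * g [:: lX; lX; lX; lX] - 8 * g [:: lX; lX] + g [::]) +i*
        (8 * g [:: lX; lX; lX; lY] - 4 * g [:: lX; lY])]`_k.

Definition circle_toeplitz (R : realType) (g : word -> R) (i j : nat) : R[i] :=
  if (j <= i)%N then circle_coef g (i - j) else (circle_coef g (j - i))^*.

(** On the circle, the modulus of the polynomial with coefficients u is unchanged after division by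
    z^2. The exponents then run from -2 to 2, and the two [cform] terms are the squares of the real
    and imaginary parts, written in 1, cos 2t, sin 2t, cos t, sin t. *)
Lemma circle_hform (R : realType) (g : word -> R) (u : 'rV[R[i]]_5) :
  g [:: lX; lY; lX; lY] = g [:: lX; lX] - g [:: lX; lX; lX; lX] ->
  let r k := complex.Re (u 0 (inord k)) in
  let q k := complex.Im (u 0 (inord k)) in
  hform (toeplitz 5 (circle_toeplitz g)) u u =
  (cform g (r 2%N) (r 4%N + r 0%N) (q 0%N - q 4%N) 0 (r 3%N + r 1%N) (q 1%N - q 3%N)
  + cform g (q 2%N) (q 4%N + q 0%N) (r 4%N - r 0%N) 0 (q 3%N + q 1%N) (r 3%N - r 1%N))%:C.
Proof.
move=> cm r q.
have S (F : nat -> R[i]) :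
    \sum_(i < 5) F i = F 0 + F 1 + F 2 + F 3 + F 4.
  by rewrite !big_ord_recr big_ord0 /= add0r.
have uE k : u 0 (inord k) = r k +i* q k by rewrite /r /q; case: (u _ _).
pose F i j := u 0 (inord i) * circle_toeplitz g i j * (u 0 (inord j))^*.
have -> : hform (toeplitz 5 (circle_toeplitz g)) u u =
    \sum_(j < 5) \sum_(i < 5) F i j.
  rewrite /hform mxE; apply: eq_bigr => j _; rewrite mxE mulr_suml.
  by apply: eq_bigr => i _; rewrite /F !mxE !inord_val.
rewrite (S (fun j => \sum_(i < 5) F i j)) !(S (F^~ _)) /F !uE.
rewrite /circle_toeplitz /= /circle_coef /=.
move: (r 0%N) (r 1%N) (r 2%N) (r 3%N) (r 4%N) => r0 r1 r2 r3 r4.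
move: (q 0%N) (q 1%N) (q 2%N) (q 3%N) (q 4%N) => q0 q1 q2 q3 q4.
rewrite /cform cm.
apply/eqP; rewrite eq_complex /=; apply/andP; split; apply/eqP; first by field. by ring.
Qed.

Lemma circle_toeplitz_psd (R : realType) (g : word -> R) :
  circle_seq g -> g [:: lX; lY; lX; lY] = g [:: lX; lX] - g [:: lX; lX; lX; lX] ->
  psdmx (moment_mx g) -> hpsd (toeplitz 5 (circle_toeplitz g)).
Proof.
move=> cg cm /(psd_momentP cg) pg; split.
  apply/matrixP => i j; rewrite !mxE /circle_toeplitz.
  case: (ltngtP i j) => [ij|ij|->]; rewrite ?leqnn ?(ltnW ij) ?leqNgt ?ij /=.
  - by [].
  - exact: conjCK.
  - by rewrite subnn /circle_coef /=; apply/eqP; rewrite eq_complex /= oppr0 !eqxx.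
move=> u; rewrite circle_hform// ler0c addr_ge0//; exact: pg.
Qed.

Lemma circle_measure (R : realType) (g : word -> R) :
  circle_seq g -> g [:: lX; lY; lX; lY] = g [:: lX; lX] - g [:: lX; lX; lX; lX] ->
  psdmx (moment_mx g) ->
  exists s : seq (R * (R * R)),
    [/\ uniq [seq p.2 | p <- s],
        forall p, p \in s -> 0 < p.1 /\ p.2.1 ^+ 2 + p.2.2 ^+ 2 = 1
      & forall w, (size w <= 4)%N ->
          g w = \sum_(p <- s) p.1 * atom_moment (atom1 p.2) w].
Proof.
move=> cg cm pg.
have shift i j : circle_toeplitz g i.+1 j.+1 = circle_toeplitz g i j.
  by rewrite /circle_toeplitz ltnS !subSS.
have [s [us hs Ts]] := caratheodory_toeplitz shift (circle_toeplitz_psd cg cm pg).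
pose re := @complex.Re R; pose im := @complex.Im R.
have w_real p : p \in s -> p.1 = (re p.1)%:C.
  move=> /hs[]; case: (p.1) => a b; rewrite ltcE /= => /andP[/eqP -> _] _.
  by [].
have circ p : p \in s -> re p.2 ^+ 2 + im p.2 ^+ 2 = 1.
  move=> /hs[_ n1]; apply: complexI.
  by rewrite -[LHS]/((re p.2 ^+ 2 + im p.2 ^+ 2)%:C) add_Re2_Im2 n1 expr1n.
have coefE k : (k < 5)%N -> circle_coef g k = \sum_(p <- s) p.1 * p.2 ^+ k.
  move=> k5; have /matrixP/(_ (inord k) 0) := Ts.
  rewrite !mxE inordK// /circle_toeplitz /= subn0 => ->.
  rewrite summxE; apply: eq_bigr => p _; rewrite !mxE big_ord1 !mxE inordK//.
  by rewrite expr0 conjC1 mulr1.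
pose S (f : R -> R -> R) := \sum_(p <- s) re p.1 * f (re p.2) (im p.2).
have SE k : (k < 5)%N -> circle_coef g k =
    S (fun x y => re ((x +i* y) ^+ k)) +i* S (fun x y => im ((x +i* y) ^+ k)).
  move=> /coefE ->; apply/eqP; rewrite eq_complex /= /S.
  have ReS (F : R[i] * R[i] -> R[i]) :
      re (\sum_(p <- s) F p) = \sum_(p <- s) re (F p).
    by apply: big_morph => [[a b] [c d]|].
  have ImS (F : R[i] * R[i] -> R[i]) :
      im (\sum_(p <- s) F p) = \sum_(p <- s) im (F p).
    by apply: big_morph => [[a b] [c d]|].
  rewrite -/re -/im ReS ImS.
  apply/andP; split; apply/eqP; rewrite big_seq [RHS]big_seq;
  apply: eq_bigr => p /w_real ->; case: (p.2) => a b /=;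
  by case: (_ ^+ k) => c d /=; rewrite mul0r ?subr0 ?addr0.
have Slin a b f h : a * S f + b * S h = S (fun x y => a * f x y + b * h x y).
  rewrite /S !mulr_sumr -big_split /=; apply: eq_bigr => p _; ring.
have Sext f h : (forall x y, x ^+ 2 + y ^+ 2 = 1 -> f x y = h x y) -> S f = S h.
  move=> fh; rewrite /S big_seq [RHS]big_seq; apply: eq_bigr => p /circ hp.
  by rewrite fh.
(* The moments in X and Y are recovered from the trigonometric ones by multiple-angle formulas, each
   a consequence of x^2 + y^2 = 1. *)
have [e0 _] : circle_coef g 0 = S (fun x y => 1) +i* S (fun x y => 0) := SE 0 isT.
have [e1 e2] : circle_coef g 1 = S (fun x y => x) +i* S (fun x y => y) := SE 1 isT.
have := SE 2 isT; rewrite /circle_coef /= => -[e3 e4].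
have := SE 3 isT; rewrite /circle_coef /= => -[e5 e6].
have := SE 4 isT; rewrite /circle_coef /= => -[e7 e8].
have xx : g [:: lX; lX] = S (fun x y => x ^+ 2).
  have -> : g [:: lX; lX] =
    2^-1 * (2 * g [:: lX; lX] - g [::]) + 2^-1 * g [::] by field.
  by rewrite e3 e0 Slin; apply: Sext => x y h; lra.
have xy : g [:: lX; lY] = S (fun x y => x * y).
  have -> : g [:: lX; lY] = 2^-1 * (2 * g [:: lX; lY]) + 0 * g [::] by field.
  by rewrite e4 e0 Slin; apply: Sext => x y h; lra.
have xxx : g [:: lX; lX; lX] = S (fun x y => x ^+ 3).
  have -> : g [:: lX; lX; lX] =
    4^-1 * (4 * g [:: lX; lX; lX] - 3 * g [:: lX]) + 3 / 4 * g [:: lX] by field.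
  rewrite e5 e1 Slin; apply: Sext => x y h.
  by have := congr1 (fun t => t * x) h; lra.
have xxy : g [:: lX; lX; lY] = S (fun x y => x ^+ 2 * y).
  have -> : g [:: lX; lX; lY] =
    4^-1 * (4 * g [:: lX; lX; lY] - g [:: lY]) + 4^-1 * g [:: lY] by field.
  rewrite e6 e2 Slin; apply: Sext => x y h.
  by have := congr1 (fun t => t * y) h; lra.
have xxxx : g [:: lX; lX; lX; lX] = S (fun x y => x ^+ 4).
  have -> : g [:: lX; lX; lX; lX] = 8^-1 *
      (8 * g [:: lX; lX; lX; lX] - 8 * g [:: lX; lX] + g [::])
      + 1 * (1 * g [:: lX; lX] + (- 8^-1) * g [::]) by field.
  rewrite e7 e0 xx !Slin; apply: Sext => x y h.
  have := congr1 (fun t => t * x ^+ 2) h; have := congr1 (fun t => t * y ^+ 2) h.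
  by lra.
have xxxy : g [:: lX; lX; lX; lY] = S (fun x y => x ^+ 3 * y).
  have -> : g [:: lX; lX; lX; lY] = 8^-1 *
      (8 * g [:: lX; lX; lX; lY] - 4 * g [:: lX; lY]) + 2^-1 * g [:: lX; lY].
    by field.
  rewrite e8 xy Slin; apply: Sext => x y h.
  by have := congr1 (fun t => t * (x * y)) h; lra.
exists [seq (re p.1, (re p.2, im p.2)) | p <- s]; split.
- have -> : [seq p.2 | p <- [seq (re p.1, (re p.2, im p.2)) | p <- s]] =
      [seq (re z, im z) | z <- [seq p.2 | p <- s]] by rewrite -!map_comp.
  by rewrite map_inj_uniq// => -[a b] [c d] [-> ->].
- move=> _ /mapP[p ps ->] /=; split; last exact: circ.
  by have := (hs p ps).1; rewrite (w_real p ps) ltcR.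
have momE w : \sum_(p <- [seq (re p.1, (re p.2, im p.2)) | p <- s])
      p.1 * atom_moment (atom1 p.2) w =
    S (fun x y => \prod_(l <- w) (if l == lX then x else y)).
  by rewrite big_map; apply: eq_bigr => p _; rewrite atom1_moment.
apply: circle_seq_ext => //.
- by apply: circle_seq_sum => _ /mapP[p ps ->]; exact/atom1_circle/circ.
all: rewrite momE.
- by rewrite e0; apply: Sext => x y h; rewrite big_nil.
- by rewrite e1; apply: Sext => x y h; rewrite !big_cons big_nil mulr1.
- by rewrite e2; apply: Sext => x y h; rewrite !big_cons big_nil mulr1.
- by rewrite xx; apply: Sext => x y h; rewrite !big_cons big_nil /=; ring.
- by rewrite xy; apply: Sext => x y h; rewrite !big_cons big_nil /=; ring.
- by rewrite xxx; apply: Sext => x y h; rewrite !big_cons big_nil /=; ring.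
- by rewrite xxy; apply: Sext => x y h; rewrite !big_cons big_nil /=; ring.
- by rewrite xxxx; apply: Sext => x y h; rewrite !big_cons big_nil /=; ring.
- by rewrite xxxy; apply: Sext => x y h; rewrite !big_cons big_nil /=; ring.
rewrite cm xx xxxx.
have -> : S (fun x y => x ^+ 2) - S (fun x y => x ^+ 4) =
    1 * S (fun x y => x ^+ 2) + (- 1) * S (fun x y => x ^+ 4) by ring.
rewrite Slin; apply: Sext => x y h; rewrite !big_cons big_nil /=.
by have := congr1 (fun t => t * x ^+ 2) h; lra.
Qed.
Local Close Scope complex_scope.

(** * Splitting an atom along its commutator *)

Lemma tr_horner_mx (R : comNzRingType) n (K : 'M[R]_n.+1) (p : {poly R}) :
  K^T = K -> (horner_mx K p)^T = horner_mx K p.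
Proof.
move=> sK; elim/poly_ind: p => [|p c IH]; first by rewrite rmorph0 trmx0.
rewrite rmorphD rmorphM /= horner_mx_X horner_mx_C linearD /= tr_scalar_mx.
congr (_ + _); rewrite trmx_mul IH sK.
by apply: esym; apply: comm_horner_mx.
Qed.

(* If X^k h(X) annihilates K, with h(0) <> 0, then so does X h(X) because K is
   diagonalizable at 0; hence h(K) / h(0) = 1 + K G projects onto ker K. *)
Lemma sym_ker_projection (R : realType) n (K : 'M[R]_n.+1) :
  K^T = K -> exists G : 'M[R]_n.+1,
    [/\ G^T = G, forall B, K * B = B * K -> G * B = B * G
      & K * (1 + K * G) = 0].
Proof.
move=> sK; have [k [h hr hk]] := multiplicity_XsubC (char_poly K) 0.
rewrite monic_neq0 ?char_poly_monic//= in hr.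
have K0 : horner_mx K h * K ^+ k = 0.
  have := Cayley_Hamilton K; rewrite hk subr0 rmorphM rmorphXn /=.
  by rewrite horner_mx_X.
have WK B : K * B = B * K -> horner_mx K h * B = B * horner_mx K h.
  by move=> KB; apply: comm_horner_mx.
have {k hk K0} K1 : K * horner_mx K h = 0.
  elim: k K0 {hk} => [|[|k] IH]; first by rewrite expr0 mulr1 => ->; rewrite mulr0.
    by rewrite expr1 => <-; rewrite WK.
  (* Symmetry lowers the exponent: the Gram product of [W * K ^+ k.+1] contains the factor
     [W * K ^+ k.+2], which is zero. *)
  move=> K0; apply: IH; apply: mxtrace_gram_eq0.
  rewrite trmx_mul tr_horner_mx//.
  have -> : (K ^+ k.+1)^T = K ^+ k.+1.
    elim: k.+1 => [|j IH]; first by rewrite trmx1.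
    by rewrite exprSr trmx_mul IH sK mulmxE -exprS exprSr.
  set W := horner_mx K h in K0 WK *.
  have KW : K * W = W * K by rewrite WK.
  have -> : K ^+ k.+1 *m W *m (W * K ^+ k.+1) =
      K ^+ k * W * (W * (K * K ^+ k.+1)).
    rewrite !mulmxE {1}exprSr -!mulrA [K * (W * _)]mulrA KW -!mulrA.
    by rewrite [K * (W * _)]mulrA KW -!mulrA.
  by rewrite -exprS K0 mulr0 raddf0.
pose g := h %/ 'X.
have hE : h = g * 'X + (h.[0])%:P.
  rewrite {1}(divp_eq h ('X - 0%:P)) modp_XsubC; congr (_ * _ + _);
  by rewrite subr0.
have h0 : h.[0] != 0 by [].
exists (horner_mx K ((h.[0])^-1 *: g)); split.
- exact: tr_horner_mx.
- by move=> B KB; apply: comm_horner_mx.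
- rewrite linearZ /= -scalerAr -[X in K * (X + _)](scale1r 1).
  rewrite -(mulVf h0) -scalerA -scalerDr -scalerAr.
  have -> : h.[0] *: 1 + K * horner_mx K g = horner_mx K h.
    rewrite [in RHS]hE rmorphD rmorphM /= horner_mx_X horner_mx_C addrC.
    rewrite scalemx1; congr (_ + _).
    by apply: esym; apply: comm_horner_mx.
  by rewrite K1 scaler0.
Qed.

(** The relation makes A^2 commute with B and B^2 with A, so C = AB - BA anticommutes with both.
    Hence K = - C^2 = C^T C commutes with both, and Q is the projection onto its kernel, which is
    that of C. *)
Lemma cut_exists (R : realType) n (A B : 'M[R]_n.+1) :
  A^T = A -> B^T = B -> A * A + B * B = 1 ->
  exists Q : 'M[R]_n.+1,
    [/\ Q^T = Q, Q * Q = Q, Q * A = A * Q /\ Q * B = B * Q,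
        Q * (A * B) = Q * (B * A)
      & forall E, E * A = A * E -> E * B = B * E ->
          \tr ((1 - Q) * E * A) = 0 /\ \tr ((1 - Q) * E * B) = 0].
Proof.
move=> sA sB AB; pose C := A * B - B * A; pose K := - (C * C).
have BBA : A * A * B = B * (A * A).
  have -> : A * A = 1 - B * B by rewrite -AB addrK.
  by rewrite mulrBl mulrBr mul1r mulr1 mulrA.
have AAB : B * B * A = A * (B * B).
  have -> : B * B = 1 - A * A by rewrite -AB addrC addKr.
  by rewrite mulrBl mulrBr mul1r mulr1 mulrA.
have CA : C * A = - (A * C).
  by rewrite /C mulrBl mulrBr opprB -!mulrA -BBA !mulrA.
have CB : C * B = - (B * C).
  by rewrite /C mulrBl mulrBr opprB -mulrA -AAB -!mulrA.
have CCcomm D : C * D = - (D * C) -> C * C * D = D * (C * C).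
  by move=> CD; rewrite -(mulrA C C D) CD mulrN (mulrA C D C) CD mulNr opprK -mulrA.
have KA : K * A = A * K by rewrite /K mulNr mulrN CCcomm.
have KB : K * B = B * K by rewrite /K mulNr mulrN CCcomm.
have sC : C^T = - C.
  by rewrite /C raddfB /= -!mulmxE !trmx_mul sA sB opprB.
have sK : K^T = K by rewrite /K raddfN /= -mulmxE trmx_mul sC mulmxN mulNmx opprK.
have [G [sG Gcomm KQ]] := sym_ker_projection sK.
pose Q := 1 + K * G; have KG : K * G = G * K by apply/esym/Gcomm.
have QE D : K * D = D * K -> Q * D = D * Q.
  move=> KD; rewrite /Q mulrDl mulrDr mul1r mulr1; congr (_ + _).
  by rewrite -mulrA (Gcomm _ KD) !mulrA KD.
have sQ : Q^T = Q.
  by rewrite /Q raddfD /= trmx1 -mulmxE trmx_mul sG sK mulmxE -KG.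
have QC : C * Q = 0.
  have CCQ : C * C * Q = 0 by apply/eqP; rewrite -oppr_eq0 -mulNr KQ.
  apply: mxtrace_gram_eq0; rewrite trmx_mul sC sQ mulmxN mulNmx !mulmxE.
  by rewrite -mulrA (mulrA C) CCQ mulr0 oppr0 raddf0.
exists Q; split=> //.
- by rewrite {2}/Q mulrDr mulr1 mulrA (QE K erefl) KQ mul0r addr0.
- by rewrite !QE.
- apply/eqP; rewrite -subr_eq0 -mulrBr -/C.
  by rewrite -trmx_eq0 -mulmxE trmx_mul sC sQ mulNmx mulmxE QC oppr0.
(* Here 1 - Q = C^2 G; carrying one factor C around the trace and past D changes the sign, so the
   trace is its own opposite. *)
have half D E : C * D = - (D * C) -> E * C = C * E -> G * C = C * G ->
    \tr ((1 - Q) * E * D) = 0.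
  move=> CD EC GC; pose F := G * E.
  have FC : F * C = C * F by rewrite /F -mulrA EC mulrA GC mulrA.
  have -> : (1 - Q) * E * D = C * (C * F * D).
    by rewrite /Q opprD addrA subrr sub0r /K !mulNr opprK /F !mulrA.
  have := mxtrace_mulC C (C * F * D); rewrite !mulmxE => trE.
  have : \tr (C * (C * F * D)) = - \tr (C * (C * F * D)).
    rewrite {1}trE -(mulrA (C * F) D C).
    have -> : D * C = - (C * D) by rewrite CD opprK.
    rewrite mulrN raddfN /=; congr (- \tr _).
    by rewrite -[in LHS]mulrA [F * (C * D)]mulrA FC !mulrA.
  by move=> h; lra.
move=> E EA EB.
have EC : E * C = C * E.
  by rewrite /C mulrBr mulrBl !mulrA EA EB -!mulrA EA EB.
have GC : G * C = C * G by apply: Gcomm; rewrite /K mulNr mulrN mulrA.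
by split; apply: half.
Qed.

Definition odd_free (R : realType) (g : word -> R) : Prop :=
  [/\ g [:: lX] = 0, g [:: lY] = 0, g [:: lX; lX; lX] = 0
    & g [:: lX; lX; lY] = 0].

(** On a circle sequence the right-hand side is the moment of XXYY, so this is the cm condition. *)
Definition commutes4 (R : realType) (g : word -> R) : Prop :=
  g [:: lX; lY; lX; lY] = g [:: lX; lX] - g [:: lX; lX; lX; lX].

(* f is the part of the sequence carried by the 2 x 2 irreducible summands of
   the atoms, h the part carried by the points of the circle. *)
Definition nc_cm_split (R : realType) (g f h : word -> R) : Prop :=
  [/\ circle_seq f, circle_seq h, psdmx (moment_mx f) /\ psdmx (moment_mx h),
      odd_free f /\ commutes4 h & forall w, g w = f w + h w].

Lemma split_atom (R : realType) (a : atom R) : atom_valid a ->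
  (tagged a).1 *m (tagged a).1 + (tagged a).2 *m (tagged a).2 = 1%:M ->
  exists f h, nc_cm_split (atom_moment a) f h.
Proof.
case: a => [[|n] [A B]] [] // _ /= sA sB AB.
have [Q [sQ QQ [QA QB] QC oddP]] := cut_exists sA sB AB.
have [PA PB] : (1 - Q) *m A = A *m (1 - Q) /\ (1 - Q) *m B = B *m (1 - Q).
  by rewrite !mulmxE !mulrBl !mulrBr !mul1r !mulr1 QA QB.
have sP : (1 - Q)^T = 1 - Q by rewrite raddfB /= trmx1 sQ.
have PP : (1 - Q) *m (1 - Q) = 1 - Q.
  by rewrite mulmxE mulrBl mul1r mulrBr mulr1 QQ subrr subr0.
have cQ : circle_seq (cut_seq Q A B) by exact: cut_seq_circle.
exists (cut_seq (1 - Q) A B), (cut_seq Q A B); split=> //.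
- exact: cut_seq_circle.
- by split; exact: cut_seq_psd.
- have AAB : A * A * B = B * (A * A).
    have -> : A * A = 1 - B * B by rewrite -[1]AB addrK.
    by rewrite mulrBl mulrBr mul1r mulr1 mulrA.
  (* Taking E = 1 kills the moments of degree 1, and E = A^2 those of degree 3. *)
  have [o1 o2] := oddP 1 (etrans (mul1r A) (esym (mulr1 A)))
    (etrans (mul1r B) (esym (mulr1 B))).
  have [o3 o4] := oddP (A * A) (esym (mulrA A A A)) AAB.
  rewrite mulr1 in o1 o2; rewrite mulrA in o3 o4.
  rewrite /odd_free /commutes4 /cut_seq /ntrace !word_mx_cons word_mx_nil /=.
  rewrite !mulmx1 !mulmxE !mulrA o1 o2 o3 o4 mulr0; split=> //.
  have -> : Q * A * B * A * B = Q * A * A - Q * A * A * A * A.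
    have BB : B * B = 1 - A * A by rewrite -[1]AB addrC addKr.
    rewrite QA -!mulrA [B * (A * B)]mulrA [Q * (B * A * B)]mulrA -QC -!mulrA BB.
    by rewrite !mulrBr !mulr1.
  by rewrite raddfB mulrBr.
- move=> w; rewrite atom_momentE /cut_seq -ntraceD -mulmxDl.
  by congr (ntrace (_ *m _)); rewrite subrK.
Qed.

Lemma cform_lin (R : realType) (g h : word -> R) (a b b0 b1 b2 b3 b4 b5 : R) :
  cform (fun w => a * g w + b * h w) b0 b1 b2 b3 b4 b5 =
  a * cform g b0 b1 b2 b3 b4 b5 + b * cform h b0 b1 b2 b3 b4 b5.
Proof. by rewrite /cform; ring. Qed.

Lemma psd_lin (R : realType) (g h : word -> R) (a b : R) :
  circle_seq g -> circle_seq h -> 0 <= a -> 0 <= b ->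
  psdmx (moment_mx g) -> psdmx (moment_mx h) ->
  psdmx (moment_mx (fun w => a * g w + b * h w)).
Proof.
move=> cg ch a0 b0 /(psd_momentP cg) pg /(psd_momentP ch) ph.
apply/psd_momentP; first exact: circle_seqD.
by move=> *; rewrite cform_lin addr_ge0// mulr_ge0.
Qed.

Lemma split_measure (R : realType) (mu : measure R) :
  (forall p, p \in mu -> [/\ 0 < p.1, atom_valid p.2
     & (tagged p.2).1 *m (tagged p.2).1 + (tagged p.2).2 *m (tagged p.2).2
       = 1%:M]) ->
  exists f h,
    nc_cm_split (fun w => \sum_(p <- mu) p.1 * atom_moment p.2 w) f h.
Proof.
elim: mu => [_|p mu IH hmu].
  pose z (w : word) : R := 0.
  have cz : circle_seq z by do !split=> //; rewrite /z subrr.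
  have pz : psdmx (moment_mx z).
    by apply/(psd_momentP cz) => *; rewrite /cform /z; lra.
  exists z, z; split=> //.
  - by split; [split | rewrite /commutes4 /z subrr].
  - by move=> w; rewrite big_nil addr0.
have [f [h [cf ch [pf ph] [[f1 f2 f3 f4] ch4] fh]]] : exists f h,
    nc_cm_split (fun w => \sum_(p <- mu) p.1 * atom_moment p.2 w) f h.
  by apply: IH => q qmu; apply: hmu; rewrite inE qmu orbT.
have [p0 pv pc] := hmu p (mem_head _ _).
have [f' [h' [cf' ch' [pf' ph'] [[f1' f2' f3' f4'] ch4'] fh']]] :=
  split_atom pv pc.
have p0' := ltW p0.
exists (fun w => p.1 * f' w + 1 * f w), (fun w => p.1 * h' w + 1 * h w).
split; try exact: circle_seqD; first by split; apply: psd_lin.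
- split.
    by split; rewrite ?f1 ?f2 ?f3 ?f4 ?f1' ?f2' ?f3' ?f4' !mulr0 addr0.
  by rewrite /commutes4 ch4 ch4'; ring.
- by move=> w; rewrite big_cons fh fh'; ring.
Qed.

(** [d] is the normalized trace of (1 - A^2 - B^2)^2. It is nonnegative on each atom and averages to
    zero, so it vanishes on every atom. *)
Lemma represents_circle (R : realType) (beta : word -> R) (mu : measure R) :
  circle_seq beta -> represents mu beta ->
  forall p, p \in mu -> [/\ 0 < p.1, atom_valid p.2
     & (tagged p.2).1 *m (tagged p.2).1 + (tagged p.2).2 *m (tagged p.2).2
       = 1%:M].
Proof.
move=> cb [_ hmu _ mom].
pose d (a : atom R) := atom_moment a [::] - 2 * atom_moment a [:: lX; lX]
  - 2 * atom_moment a [:: lY; lY] + atom_moment a [:: lX; lX; lX; lX]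
  + atom_moment a [:: lX; lX; lY; lY] + atom_moment a [:: lY; lY; lX; lX]
  + atom_moment a [:: lY; lY; lY; lY].
have dE t (A B : 'M[R]_t) : A^T = A -> B^T = B ->
    d (existT _ t (A, B)) =
    ntrace ((1%:M - (A *m A + B *m B))^T *m (1%:M - (A *m A + B *m B))).
  move=> sA sB; rewrite [(_ - _)^T]raddfB /= [(_ + _)^T]raddfD /=.
  rewrite trmx1 !trmx_mul sA sB.
  rewrite !(mulmxDl, mulmxDr, mulNmx, mulmxN, mul1mx, mulmx1).
  rewrite /d /atom_moment /= !word_mx_cons word_mx_nil /= !mulmx1 /ntrace.
  by rewrite !(mxtraceD, raddfN) /= !(mulmxA, mxtraceD, raddfN) /=; ring.
have sum0 : \sum_(p <- mu) p.1 * d p.2 = 0.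
  have -> : \sum_(p <- mu) p.1 * d p.2 =
      beta [::] - 2 * beta [:: lX; lX] - 2 * beta [:: lY; lY]
      + beta [:: lX; lX; lX; lX] + beta [:: lX; lX; lY; lY]
      + beta [:: lY; lY; lX; lX] + beta [:: lY; lY; lY; lY].
    rewrite !mom// !mulr_sumr -!sumrN -!big_split /=.
    by apply: eq_bigr => p _; rewrite /d; ring.
  by rewrite !(circle_words cb); ring.
have d0 p : p \in mu -> 0 <= d p.2.
  move=> /hmu[_]; case: (p.2) => t [A B] [/= _ sA sB]; rewrite dE//.
  by rewrite mulr_ge0 ?invr_ge0// mxtrace_gram_ge0.
move=> p pmu; have [p0 pv] := hmu p pmu; split=> //.
have : d p.2 = 0.
  move: sum0 => /eqP; rewrite big_seq psumr_eq0 => [/allP/(_ p pmu)|q qmu].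
    by rewrite pmu /= mulf_eq0 gt_eqF//= => /eqP.
  by rewrite mulr_ge0 ?d0// ltW// (hmu q qmu).1.
case: (p.2) pv => t [A B] [/= t0 sA sB]; rewrite dE// => /eqP.
rewrite mulf_eq0 invr_eq0 pnatr_eq0 gtn_eqF//= => /eqP /mxtrace_gram_eq0 /eqP.
by rewrite subr_eq0 => /eqP <-.
Qed.

(** * The 2 x 2 pairs *)

Lemma Xmat_sqr (R : realType) (a1 : R) : 0 <= a1 ->
  Xmat a1 *m Xmat a1 = a1%:M.
Proof.
move=> a0; have s := sqr_sqrtr a0; rewrite expr2 in s.
apply/matrixP => i j; rewrite !mxE !big_ord_recl big_ord0 !mxE /=.
by case: i => [[|[|]]] // ?; case: j => [[|[|]]] // ? /=;
  rewrite ?mulr1n ?mulr0n; lra.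
Qed.

Lemma Ymat_sqr (R : realType) (a1 a2 : R) : 0 < a1 < 1 ->
  - (2 * Num.sqrt (a1 * (1 - a1))) < a2 < 2 * Num.sqrt (a1 * (1 - a1)) ->
  Ymat a1 a2 *m Ymat a1 a2 = (1 - a1)%:M.
Proof.
move=> /andP[a0 a11] ha; set s := Num.sqrt (a1 * (1 - a1)) in ha.
have b0 : 0 <= 1 - a1 by lra.
have s0 : 0 < s by rewrite sqrtr_gt0 mulr_gt0//; lra.
have := sqr_sqrtr b0; rewrite expr2 => sb.
set a := a2 / s.
have a4 : 0 <= 4 - a ^+ 2.
  have : `|a| <= 2.
    rewrite /a normrM normfV (gtr0_norm s0) ler_pdivrMr// ler_norml.
    by case/andP: ha => h1 h2; apply/andP; split; lra.
  rewrite -ler_sqr ?nnegrE// real_normK ?num_real//; lra.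
have := sqr_sqrtr a4; rewrite expr2 => sq.
apply/matrixP => i j; rewrite !mxE !big_ord_recl big_ord0 !mxE /= -/s -/a.
set c := Num.sqrt (4 - a ^+ 2) in sq *; set e := Num.sqrt (1 - a1) in sb *.
case: i => [[|[|]]] // ?; case: j => [[|[|]]] // ? /=;
  rewrite ?mulr1n ?mulr0n.
- transitivity (e * e * (a ^+ 2 + c * c) / 4); first by field.
  by rewrite sq sb; field.
- by field.
- by field.
- transitivity (e * e * (a ^+ 2 + c * c) / 4); first by field.
  by rewrite sq sb; field.
Qed.

Lemma XYmat_anticomm (R : realType) (a1 a2 : R) : 0 < a1 < 1 ->
  Xmat a1 *m Ymat a1 a2 + Ymat a1 a2 *m Xmat a1 = a2%:M.
Proof.
move=> /andP[a0 a11].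
have s0 : Num.sqrt a1 != 0 by rewrite sqrtr_eq0 -ltNge.
have e0 : Num.sqrt (1 - a1) != 0 by rewrite sqrtr_eq0 -ltNge; lra.
apply/matrixP => i j; rewrite !mxE !big_ord_recl !big_ord0 !mxE /=.
rewrite sqrtrM; last exact: ltW.
by case: i => [[|[|]]] // ?; case: j => [[|[|]]] // ? /=;
  rewrite ?mulr1n ?mulr0n; field; rewrite ?s0 ?e0.
Qed.

Lemma Xmat_tr (R : realType) (a1 : R) : (Xmat a1)^T = Xmat a1.
Proof.
by apply/matrixP => i j; rewrite !mxE;
  case: i => [[|[|]]] // ?; case: j => [[|[|]]] // ?.
Qed.

Lemma Ymat_tr (R : realType) (a1 a2 : R) : (Ymat a1 a2)^T = Ymat a1 a2.
Proof.
by apply/matrixP => i j; rewrite !mxE;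
  case: i => [[|[|]]] // ?; case: j => [[|[|]]] // ?.
Qed.

Lemma Xmat_trace (R : realType) (a1 : R) : \tr (Xmat a1) = 0.
Proof. by rewrite /mxtrace !big_ord_recl big_ord0 !mxE /=; ring. Qed.

Lemma Ymat_trace (R : realType) (a1 a2 : R) : \tr (Ymat a1 a2) = 0.
Proof. by rewrite /mxtrace !big_ord_recl big_ord0 !mxE /=; ring. Qed.

Definition pair_seq (R : realType) (a1 a2 : R) (w : word) : R :=
  ntrace (word_mx (Xmat a1) (Ymat a1 a2) w).

Lemma pair_seq_values (R : realType) (a1 a2 : R) : 0 < a1 < 1 ->
  - (2 * Num.sqrt (a1 * (1 - a1))) < a2 < 2 * Num.sqrt (a1 * (1 - a1)) ->
  let g := pair_seq a1 a2 in
  [/\ circle_seq g, odd_free g &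
  [/\ g [::] = 1, g [:: lX; lX] = a1, g [:: lX; lY] = a2 / 2,
    g [:: lX; lX; lX; lX] = a1 ^+ 2 &
    g [:: lX; lX; lX; lY] = a1 * a2 / 2 /\
    g [:: lX; lY; lX; lY] = a2 ^+ 2 / 2 - a1 * (1 - a1)]].
Proof.
move=> h1 h2 g; have /andP[a0 a11] := h1.
have XX := Xmat_sqr (ltW a0); have YY := Ymat_sqr h1 h2.
have XY := XYmat_anticomm a2 h1.
set X := Xmat a1 in XX XY *; set Y := Ymat a1 a2 in YY XY *.
have n1 : ntrace (1%:M : 'M[R]_2) = 1 by rewrite /ntrace mxtrace1 mulVf ?pnatr_eq0.
have nX : ntrace X = 0 by rewrite /ntrace Xmat_trace mulr0.
have nY : ntrace Y = 0 by rewrite /ntrace Ymat_trace mulr0.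
have nXY : ntrace (X *m Y) = a2 / 2.
  have : ntrace (X *m Y) + ntrace (Y *m X) = a2.
    by rewrite -ntraceD XY -[RHS]mulr1 -n1 -ntraceZ scalemx1.
  by rewrite {2}/ntrace mxtrace_mulC -/(ntrace _) => <-; field.
have nS (a : R) (B : 'M[R]_2) : ntrace (a%:M *m B) = a * ntrace B.
  by rewrite mul_scalar_mx ntraceZ.
split.
- suff : circle_seq (cut_seq 1%:M X Y).
    by congr circle_seq; apply/funext => w; rewrite /cut_seq mul1mx.
  apply: cut_seq_circle; rewrite ?Xmat_tr ?Ymat_tr ?tr_scalar_mx ?mul1mx ?mulmx1//.
  by rewrite XX YY -raddfD /= addrC subrK.
- rewrite /odd_free /g /pair_seq !word_mx_cons word_mx_nil /= -/X -/Y !mulmx1.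
  by rewrite !mulmxA XX !nS nX nY !mulr0.
rewrite /g /pair_seq !word_mx_cons word_mx_nil /= -/X -/Y !mulmx1.
have YX : Y *m X = a2%:M - X *m Y by rewrite -XY addrC addKr.
have XYXY : X *m (Y *m (X *m Y)) = a2%:M *m (X *m Y) - (a1 * (1 - a1))%:M *m 1%:M.
  rewrite (mulmxA Y) YX mulmxBl mulmxBr -!mulmxA YY (mulmxA X X) XX.
  by rewrite mulmx1 -scalar_mxM !mul_scalar_mx scalemxAr.
have nN (B : 'M[R]_2) : ntrace (- B) = - ntrace B.
  by rewrite /ntrace raddfN mulrN.
have nSS (c : R) : ntrace (c%:M : 'M[R]_2) = c.
  by rewrite -[c%:M]mulmx1 nS n1 mulr1.
split; rewrite ?XX ?nSS//; first by rewrite mulmxA XX nS nSS expr2.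
split; first by rewrite mulmxA XX nS nXY mulrA.
by rewrite XYXY ntraceD nN !nS n1 nXY; field.
Qed.

Lemma cform_eq (R : realType) (g h : word -> R) (b0 b1 b2 b3 b4 b5 : R) :
  (forall w, (size w <= 4)%N -> g w = h w) ->
  cform g b0 b1 b2 b3 b4 b5 = cform h b0 b1 b2 b3 b4 b5.
Proof. by move=> gh; rewrite /cform !gh. Qed.

(** * Rank, kernel and variety *)

Lemma card_le_seq (T : eqType) (s : seq T) (V : set T) n :
  uniq s -> (n <= size s)%N -> (forall x, x \in s -> V x) -> (`I_n #<= V)%card.
Proof.
case: s => [|x0 s0] us ns sV.
  by move: ns; rewrite leqn0 => /eqP ->; rewrite II0; exact: card_ge0.
have inj : {in `I_n &, injective (nth x0 (x0 :: s0))}.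
  move=> i j /set_mem /= iN /set_mem /= jN /eqP.
  by rewrite nth_uniq ?(leq_trans _ ns)// => /eqP.
rewrite -(card_le_eql (inj_card_eq inj)); apply: subset_card_le.
by move=> _ [i iN <-]; apply: sV; rewrite mem_nth// (leq_trans _ ns).
Qed.

Definition point_vec (R : realType) (z : R * R) : 'cV[R]_7 :=
  \col_i atom_moment (atom1 z) (tnth basis i).

Lemma column_evalE (R : realType) (M : 'M[R]_7) (g : {poly {poly R}}) :
  exists v : 'cV[R]_7, column_eval M g = M *m v /\
    (deg_le2 g -> forall z, (v^T *m point_vec z) 0 0 = g.[z.1%:P].[z.2]).
Proof.
pose e w : 'cV[R]_7 := delta_mx (inord (index w basis)) 0.
exists (\sum_(i < 3) \sum_(j < 3 | (i + j <= 2)%N)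
    g`_i`_j *: e (nseq i lX ++ nseq j lY)); split.
  rewrite mulmx_sumr; apply: eq_bigr => i _; rewrite mulmx_sumr.
  by apply: eq_bigr => j _; rewrite -scalemxAr /mcol colE.
move=> dg z.
have sg : (size g <= 3)%N.
  apply/leq_sizeP => i i3; apply/polyP => j; rewrite coef0.
  by apply: dg; rewrite ltn_addr.
have sgi i : (size (g`_i)%R <= 3)%N.
  by apply/leq_sizeP => j j3; apply: dg; rewrite ltn_addl.
rewrite (horner_coef_wide _ sg) horner_sum raddf_sum mulmx_suml summxE.
apply: eq_bigr => i _ /=; rewrite -rmorphXn hornerM hornerC.
rewrite (horner_coef_wide _ (sgi i)) raddf_sum mulmx_suml summxE mulr_suml.
rewrite [RHS](bigID (fun j : 'I_3 => (i + j <= 2)%N)) /= [X in _ + X]big1.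
  rewrite addr0; apply: eq_bigr => j ij.
  rewrite linearZ /= -scalemxAl mxE -mulrA; congr (_ * _).
  rewrite trmx_delta -rowE !mxE (tnth_nth [::]) inordK.
    rewrite nth_index; last first.
      by case: i ij => [[|[|[|]]]] // ?; case: j => [[|[|[|]]]] // ?.
    rewrite atom1_moment big_cat /= !big_nseq /= mulrC.
    by rewrite !iter_mulr_1.
  by case: i ij => [[|[|[|]]]] // ?; case: j => [[|[|[|]]]] // ?.
by move=> j; rewrite -ltnNge => ij; rewrite dg// !mul0r.
Qed.

(** The atoms of a measure on the circle bound the rank from above, one rank-one term each. They lie
    in the variety: a column relation g gives zero as a positive combination of the squares of the
    values of g at the atoms. *)
Lemma rank_le_variety (R : realType) (g : word -> R) :
  circle_seq g -> commutes4 g -> psdmx (moment_mx g) ->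
  (`I_(\rank (moment_mx g)) #<= variety (moment_mx g))%card.
Proof.
move=> cg cm pg; have [s [us hs gs]] := circle_measure cg cm pg.
have ME : moment_mx g =
    \sum_(p <- s) p.1 *: (point_vec p.2 *m (point_vec p.2)^T).
  apply/matrixP => i j; rewrite mxE gs; last first.
    by rewrite size_cat size_rev (leq_add (basis_word_size i) (basis_word_size j)).
  rewrite summxE; apply: eq_bigr => p _; rewrite !mxE big_ord1 !mxE.
  rewrite !atom1_moment big_cat /=; congr (_ * (_ * _)).
  by rewrite (perm_big _ (permEl (perm_rev _))).
apply: (card_le_seq us).
- rewrite size_map ME.
  elim: (s) => [|p s' IH]; first by rewrite big_nil mxrank0.
  rewrite big_cons (leq_trans (mxrank_add _ _))//= -(add1n (size s')) leq_add//.
  by rewrite scalemxAl mulmx_max_rank.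
- move=> _ /mapP[p ps ->] q dq.
  have [v [-> /(_ dq) vE]] := column_evalE (moment_mx g) q => Mv.
  rewrite -vE; have : (v^T *m moment_mx g *m v) 0 0 = 0.
    by rewrite -mulmxA Mv mulmx0 mxE.
  have -> : (v^T *m moment_mx g *m v) 0 0 =
      \sum_(p <- s) p.1 * (v^T *m point_vec p.2) 0 0 ^+ 2.
    rewrite ME mulmx_sumr mulmx_suml summxE; apply: eq_bigr => r _.
    rewrite -scalemxAr -scalemxAl [LHS]mxE; congr (_ * _).
    rewrite (mulmxA v^T) -(mulmxA _ _ v) [LHS]mxE big_ord1 expr2; congr (_ * _).
    have -> : (point_vec r.2)^T *m v = (v^T *m point_vec r.2)^T.
      by rewrite trmx_mul trmxK.
    by rewrite [LHS]mxE.
  move=> /eqP; rewrite big_seq psumr_eq0 => [/allP/(_ p ps)|r /hs[r0 _]].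
    by rewrite ps /= mulf_eq0 gt_eqF ?(hs p ps).1//= sqrf_eq0 => /eqP.
  by rewrite mulr_ge0 ?sqr_ge0// ltW.
Qed.

Lemma psd_rank_le (R : realType) n (A B : 'M[R]_n) :
  psdmx A -> psdmx B ->
  (forall v : 'cV_n, (v^T *m A *m v) 0 0 = 0 -> (v^T *m B *m v) 0 0 = 0) ->
  (\rank B <= \rank A)%N.
Proof.
move=> pA pB h; apply: mxrank_le_ker => v vA.
rewrite -[v *m B]trmxK trmx_mul pB.1 (psdmx_ker pB) ?trmx0//.
by apply: h; rewrite trmxK vA mul0mx mxE.
Qed.

Lemma psd_rank_lt (R : realType) n (A B : 'M[R]_n) (w : 'cV[R]_n) :
  psdmx A -> psdmx B ->
  (forall v : 'cV_n, (v^T *m A *m v) 0 0 = 0 -> (v^T *m B *m v) 0 0 = 0) ->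
  (w^T *m A *m w) 0 0 != 0 -> (w^T *m B *m w) 0 0 = 0 ->
  (\rank B < \rank A)%N.
Proof.
move=> pA pB h wA wB; apply: (mxrank_lt_ker (w := w^T)).
- move=> v vA; rewrite -[v *m B]trmxK trmx_mul pB.1 (psdmx_ker pB) ?trmx0//.
  by apply: h; rewrite trmxK vA mul0mx mxE.
- by apply: contraNneq wA => ->; rewrite mul0mx mxE.
- by rewrite -[w^T *m B]trmxK trmx_mul pB.1 trmxK (psdmx_ker pB wB) trmx0.
Qed.

(** For the pair attached to (a1, a2), X^2 - Y^2 and XY + YX are the scalars p = 2 a1 - 1 and q =
    a2. Since 4 a1 (1 - a1) = 1 - p^2, the bounds on a2 describe the open disc. *)
Lemma disc_param (R : realType) (p q : R) : p ^+ 2 + q ^+ 2 < 1 ->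
  let a1 := (1 + p) / 2 in
  0 < a1 < 1 /\
  - (2 * Num.sqrt (a1 * (1 - a1))) < q < 2 * Num.sqrt (a1 * (1 - a1)).
Proof.
move=> pq a1; have p2 : p ^+ 2 < 1 by have := sqr_ge0 q; lra.
have : `|p| < 1.
  by rewrite -(ltr_pXn2r (n := 2)) ?nnegrE ?ler01// real_normK ?num_real// expr1n.
rewrite ltr_norml => /andP[p0 p1].
have a0 : 0 < a1 < 1 by rewrite /a1; apply/andP; split; lra.
split=> //; rewrite -ltr_norml.
have s0 : 0 <= 2 * Num.sqrt (a1 * (1 - a1)) by rewrite mulr_ge0// sqrtr_ge0.
rewrite -(ltr_pXn2r (n := 2)) ?nnegrE// real_normK ?num_real// exprMn.
rewrite sqr_sqrtr; first by rewrite /a1; lra.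
by case/andP: a0 => ? ?; rewrite mulr_ge0//; lra.
Qed.

Lemma pair_cform (R : realType) (p q b0 b1 b2 b3 b4 b5 : R) :
  p ^+ 2 + q ^+ 2 < 1 ->
  cform (pair_seq ((1 + p) / 2) q) b0 b1 b2 b3 b4 b5 =
  (b0 + p * b1 + q * b2) ^+ 2 + (1 - p ^+ 2 - q ^+ 2) * b3 ^+ 2
  + ((1 + p) / 2 * b4 ^+ 2 + q * b4 * b5 + (1 - p) / 2 * b5 ^+ 2).
Proof.
move=> /disc_param[h1 h2].
have [_ [o1 o2 o3 o4] [e1 e2 e3 e4 [e5 e6]]] := pair_seq_values h1 h2.
by rewrite /cform o1 o2 o3 o4 e1 e2 e3 e4 e5 e6; field.
Qed.

Lemma disc_form_ge0 (R : realType) (p q b4 b5 : R) : p ^+ 2 + q ^+ 2 < 1 ->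
  0 <= (1 + p) / 2 * b4 ^+ 2 + q * b4 * b5 + (1 - p) / 2 * b5 ^+ 2.
Proof.
move=> pq; have [/andP[a0 _] _] := disc_param pq.
rewrite -(pmulr_rge0 _ a0).
have -> : (1 + p) / 2 * ((1 + p) / 2 * b4 ^+ 2 + q * b4 * b5
   + (1 - p) / 2 * b5 ^+ 2) = ((1 + p) / 2 * b4 + q / 2 * b5) ^+ 2
   + (1 - p ^+ 2 - q ^+ 2) * (b5 / 2) ^+ 2 by field.
by rewrite addr_ge0 ?sqr_ge0// mulr_ge0 ?sqr_ge0//; lra.
Qed.

(** * Subtracting the atom at the mean point *)

Definition even_form (R : realType) (m u v uu uv vv b0 b1 b2 b3 b4 b5 : R) : R :=
  m * b0 ^+ 2 + uu * b1 ^+ 2 + vv * b2 ^+ 2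
  + 2 * (u * b0 * b1 + v * b0 * b2 + uv * b1 * b2)
  + (m - uu - vv) * b3 ^+ 2
  + (m + u) / 2 * b4 ^+ 2 + v * b4 * b5 + (m - u) / 2 * b5 ^+ 2.

Lemma cform_odd_free (R : realType) (g : word -> R) (b0 b1 b2 b3 b4 b5 : R) :
  odd_free g -> cform g b0 b1 b2 b3 b4 b5 =
  even_form (g [::]) (2 * g [:: lX; lX] - g [::]) (2 * g [:: lX; lY])
    (4 * g [:: lX; lX; lX; lX] - 4 * g [:: lX; lX] + g [::])
    (4 * g [:: lX; lX; lX; lY] - 2 * g [:: lX; lY])
    (2 * g [:: lX; lY; lX; lY]
       + 2 * (g [:: lX; lX] - g [:: lX; lX; lX; lX])) b0 b1 b2 b3 b4 b5.
Proof.
by move=> [g1 g2 g3 g4]; rewrite /cform /even_form g1 g2 g3 g4; ring.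
Qed.

Lemma mean_atom (R : realType) (m u v uu uv vv : R) :
  (forall b0 b1 b2 b3 b4 b5, 0 <= even_form m u v uu uv vv b0 b1 b2 b3 b4 b5) ->
  0 < m - uu - vv ->
  exists p q xi, [/\ p ^+ 2 + q ^+ 2 < 1, 0 < xi,
    xi * (1 - p ^+ 2 - q ^+ 2) = m - uu - vv &
    forall b0 b1 b2 b3 b4 b5, 0 <= even_form m u v uu uv vv b0 b1 b2 b3 b4 b5
      - xi * ((b0 + p * b1 + q * b2) ^+ 2 + (1 - p ^+ 2 - q ^+ 2) * b3 ^+ 2
      + ((1 + p) / 2 * b4 ^+ 2 + q * b4 * b5 + (1 - p) / 2 * b5 ^+ 2))].
Proof.
move=> F w0.
have uu0 : 0 <= uu by have := F 0 1 0 0 0 0; rewrite /even_form; lra.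
have vv0 : 0 <= vv by have := F 0 0 1 0 0 0; rewrite /even_form; lra.
have m0 : 0 < m by lra.
pose p := u / m; pose q := v / m.
have uE : u = m * p by rewrite /p mulrC divfK ?gt_eqF.
have vE : v = m * q by rewrite /q mulrC divfK ?gt_eqF.
(* The form at u - p and at v - q: both variances are nonnegative. *)
have hA : m * p ^+ 2 <= uu.
  by have := F (- p) 1 0 0 0 0; rewrite /even_form uE; lra.
have hB : m * q ^+ 2 <= vv.
  by have := F (- q) 0 1 0 0 0; rewrite /even_form vE; lra.
have D0 : 0 < 1 - p ^+ 2 - q ^+ 2 by rewrite -(pmulr_rgt0 _ m0); lra.
pose xi := (m - uu - vv) / (1 - p ^+ 2 - q ^+ 2).
have xiD : xi * (1 - p ^+ 2 - q ^+ 2) = m - uu - vv by rewrite divfK ?gt_eqF.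
have xim : xi <= m by rewrite ler_pdivrMr//; lra.
have xi0 : 0 < xi by rewrite divr_gt0.
move: (xi) xiD xim xi0 => {}xi xiD xim xi0.
exists p, q, xi; split=> //; first by lra.
move=> b0 b1 b2 b3 b4 b5; have pq : p ^+ 2 + q ^+ 2 < 1 by lra.
have G : 0 <= (m - xi) * ((b0 + p * b1 + q * b2) ^+ 2
    + ((1 + p) / 2 * b4 ^+ 2 + q * b4 * b5 + (1 - p) / 2 * b5 ^+ 2)).
  by rewrite mulr_ge0 ?subr_ge0// addr_ge0 ?sqr_ge0// disc_form_ge0.
(* The form is m times the square at the mean plus a variance, the latter being F at the centered
   vector. Subtracting the atom lowers m to m - xi and cancels the b3 term exactly. *)
have := addr_ge0 G (F (- (b1 * p + b2 * q)) b1 b2 0 0 0).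
have E S T : xi * (S + (1 - p ^+ 2 - q ^+ 2) * b3 ^+ 2 + T) =
    xi * (S + T) + (m - uu - vv) * b3 ^+ 2 by rewrite -xiD; ring.
by congr (_ <= _); rewrite E /even_form uE vE; field.
Qed.

(** Case (2) of the theorem word for word, with the parameters and xi fixed, so that the two unfold
    to each other. *)
Definition pair_reduction (R : realType) (beta : word -> R) (a1 a2 xi : R) :
    Prop :=
  let M2 := moment_mx beta in
  let M2XY := pair_moment_mx (Xmat a1) (Ymat a1 a2) in
  let M := M2 - xi *: M2XY in
  [/\ 0 < a1 < 1,
      - (2 * Num.sqrt (a1 * (1 - a1))) < a2 < 2 * Num.sqrt (a1 * (1 - a1)),
      [/\ 0 < xi, (\rank M < \rank M2)%N
        & forall eta : R, 0 < eta ->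
            (\rank (M2 - eta *: M2XY)%R < \rank M2)%N -> xi <= eta]
    & [/\ psdmx M, cm_moment_mx M & (`I_(\rank M) #<= variety M)%card]].

Lemma moment_mx_sub (R : realType) (beta : word -> R) (a1 a2 xi : R) :
  moment_mx beta - xi *: pair_moment_mx (Xmat a1) (Ymat a1 a2) =
  moment_mx (fun w => 1 * beta w + (- xi) * pair_seq a1 a2 w).
Proof. by apply/matrixP => i j; rewrite !mxE mul1r mulNr. Qed.

(* If M2 - xi P and M2 are positive, so is M2 - eta P for eta < xi, and it has
   no larger kernel than M2. *)
Lemma pair_reduction_intro (R : realType) (beta : word -> R) (p q xi : R) :
  circle_seq beta -> psdmx (moment_mx beta) ->
  p ^+ 2 + q ^+ 2 < 1 -> 0 < xi ->
  xi * (1 - p ^+ 2 - q ^+ 2) =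
    2 * (beta [:: lX; lX] - beta [:: lX; lX; lX; lX]
         - beta [:: lX; lY; lX; lY]) ->
  (forall b0 b1 b2 b3 b4 b5,
     0 <= cform beta b0 b1 b2 b3 b4 b5
          - xi * cform (pair_seq ((1 + p) / 2) q) b0 b1 b2 b3 b4 b5) ->
  pair_reduction beta ((1 + p) / 2) q xi.
Proof.
move=> cb pb pq xi0 hxi hpos; have [h1 h2] := disc_param pq.
have [cP [o1 o2 o3 o4] [e1 e2 e3 e4 [e5 e6]]] := pair_seq_values h1 h2.
pose d eta w := 1 * beta w + (- eta) * pair_seq ((1 + p) / 2) q w.
have cd eta : circle_seq (d eta) by exact: circle_seqD.
have dE eta b0 b1 b2 b3 b4 b5 : cform (d eta) b0 b1 b2 b3 b4 b5 =
    cform beta b0 b1 b2 b3 b4 b5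
    - eta * cform (pair_seq ((1 + p) / 2) q) b0 b1 b2 b3 b4 b5.
  by rewrite cform_lin; ring.
have pd : psdmx (moment_mx (d xi)).
  by apply/psd_momentP => // *; rewrite dE.
have P0 (b0 b1 b2 b3 b4 b5 : R) :
    0 <= cform (pair_seq ((1 + p) / 2) q) b0 b1 b2 b3 b4 b5.
  rewrite pair_cform//; have := disc_form_ge0 b4 b5 pq.
  have := sqr_ge0 (b0 + p * b1 + q * b2).
  have : 0 <= (1 - p ^+ 2 - q ^+ 2) * b3 ^+ 2.
    by rewrite mulr_ge0 ?sqr_ge0//; lra.
  by lra.
have cmd : commutes4 (d xi).
  by rewrite /commutes4 /d e2 e4 e6; lra.
(* The coefficient vector of XY - YX. The hypothesis on xi puts it in the kernel of the difference,
   while it is not in the kernel of M2; this is the drop in rank. *)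
pose w : 'cV[R]_7 := form_vec 0 0 0 1 0 0.
have wd : (w^T *m moment_mx (d xi) *m w) 0 0 = 0.
  by rewrite moment_form_vec// dE pair_cform// /cform; lra.
have wb : (w^T *m moment_mx beta *m w) 0 0 != 0.
  rewrite moment_form_vec//; apply: lt0r_neq0.
  have : 0 < xi * (1 - p ^+ 2 - q ^+ 2) by rewrite mulr_gt0//; lra.
  by rewrite hxi /cform; lra.
have form_d eta (v : 'cV[R]_7) : (v^T *m moment_mx (d eta) *m v) 0 0 =
  (v^T *m moment_mx beta *m v) 0 0 - eta * (v^T *m moment_mx (pair_seq ((1 + p) / 2) q) *m v) 0 0.
  by rewrite !moment_form// dE.
have pairM_ge0 (v : 'cV[R]_7) :
    0 <= (v^T *m moment_mx (pair_seq ((1 + p) / 2) q) *m v) 0 0.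
  by rewrite moment_form.
rewrite /pair_reduction /= moment_mx_sub -/(d xi); split=> //.
- split=> //.
    apply: (psd_rank_lt pb pd _ wb wd) => v vb.
    apply/eqP; rewrite eq_le pd.2 andbT form_d vb sub0r oppr_le0.
    by rewrite mulr_ge0// ltW.
  move=> eta eta0; rewrite moment_mx_sub -/(d eta) => rk.
  rewrite leNgt; apply/negP => lt; move: rk; rewrite ltnNge => /negP; apply.
  have key (v : 'cV[R]_7) : (v^T *m moment_mx (d eta) *m v) 0 0 =
      (1 - eta / xi) * (v^T *m moment_mx beta *m v) 0 0
      + eta / xi * (v^T *m moment_mx (d xi) *m v) 0 0.
    by rewrite !form_d; field; rewrite gt_eqF.
  have r0 : 0 <= eta / xi by rewrite divr_ge0// ltW.
  have r1 : 0 < 1 - eta / xi by rewrite subr_gt0 ltr_pdivrMr// mul1r.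
  have pe : psdmx (moment_mx (d eta)).
    split; first exact: moment_mx_sym (cd eta).1.
    by move=> v; rewrite key addr_ge0// mulr_ge0 ?pb.2 ?pd.2// ltW.
  apply: (psd_rank_le pe pb) => v; rewrite key => /eqP.
  rewrite paddr_eq0; last 2 first.
  + by rewrite mulr_ge0 ?pb.2// ltW.
  + by rewrite mulr_ge0 ?pd.2.
  by rewrite mulf_eq0 gt_eqF//= => /andP[/eqP].
- split=> //; last exact: rank_le_variety.
  exists (d xi) => //; split; first exact: (cd xi).1.
  by rewrite cmd (circle_words (cd xi)).
Qed.

(* The mean (p, q) of the measure of the 2 x 2 part on the disc gives the atom:
   replacing that part by xi times the atom leaves a positive remainder, since
   its second moments dominate those of the mean and xi is at most its mass. *)
Lemma pair_reduction_of_split (R : realType) (beta g f h : word -> R) :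
  circle_seq beta -> psdmx (moment_mx beta) ->
  beta [:: lX; lX; lY; lY] <> beta [:: lX; lY; lX; lY] ->
  (forall w, (size w <= 4)%N -> beta w = g w) -> nc_cm_split g f h ->
  exists a1 a2 xi, pair_reduction beta a1 a2 xi.
Proof.
move=> cb pb nc bg [cf ch [pf ph] [[f1 f2 f3 f4] cmh] gE].
have bE w : (size w <= 4)%N -> beta w = 1 * f w + 1 * h w.
  by move=> /bg ->; rewrite gE !mul1r.
have F b0 b1 b2 b3 b4 b5 : 0 <= cform f b0 b1 b2 b3 b4 b5.
  by have /(psd_momentP cf) := pf; apply.
have H b0 b1 b2 b3 b4 b5 : 0 <= cform h b0 b1 b2 b3 b4 b5.
  by have /(psd_momentP ch) := ph; apply.
have fo : odd_free f by [].
have ev b0 b1 b2 b3 b4 b5 := cform_odd_free b0 b1 b2 b3 b4 b5 fo.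
(* The commutator coefficient of f is that of beta, as h contributes none; its vanishing would
   contradict the nc hypothesis. *)
have q0 : 0 < f [::] - (4 * f [:: lX; lX; lX; lX] - 4 * f [:: lX; lX] + f [::])
    - (2 * f [:: lX; lY; lX; lY] + 2 * (f [:: lX; lX] - f [:: lX; lX; lX; lX])).
  rewrite lt_neqAle; apply/andP; split.
    apply/eqP => e; apply: nc; rewrite (circle_words cb) !bE// cmh; lra.
  by have := F 0 0 0 1 0 0; rewrite ev /even_form; lra.
have F' b0 b1 b2 b3 b4 b5 := eq_ind _ (fun x => 0 <= x)
  (F b0 b1 b2 b3 b4 b5) _ (ev b0 b1 b2 b3 b4 b5).
have [p [q [xi [pq xi0 hxi G]]]] := mean_atom F' q0.
exists ((1 + p) / 2), q, xi; apply: pair_reduction_intro => //.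
  by rewrite hxi !bE// cmh; ring.
move=> b0 b1 b2 b3 b4 b5.
rewrite (cform_eq b0 b1 b2 b3 b4 b5 bE) cform_lin !mul1r addrAC.
by rewrite addr_ge0// pair_cform// ev.
Qed.

(** * Constructing measures *)

Definition atom2 (R : realType) (a1 a2 : R) : atom R :=
  existT _ 2%N (Xmat a1, Ymat a1 a2).

Definition pair_measure (R : realType) (a1 a2 xi : R) (s : seq (R * (R * R))) :
  measure R := (xi, atom2 a1 a2) :: [seq (p.1, atom1 p.2) | p <- s].

Lemma pair_measure_type (R : realType) (a1 a2 xi : R) (s : seq (R * (R * R))) :
  has_type (pair_measure a1 a2 xi s) [:: size s; 1%N].
Proof.
split=> // i; rewrite /= count_map.
case: i => [|i]; first by rewrite add0n -[RHS]count_predT; apply: eq_count.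
rewrite (eq_count (a2 := pred0)) ?count_pred0 ?addn0//.
by case: i => [|[|i]].
Qed.

Lemma atom1_inj (R : realType) : injective (@atom1 R).
Proof.
move=> [x y] [x' y'] e.
have E w : atom_moment (atom1 (x, y)) w = atom_moment (atom1 (x', y')) w.
  by rewrite e.
have := E [:: lX]; have := E [:: lY]; rewrite !atom1_moment !big_cons !big_nil /=.
by rewrite !mulr1 => -> ->.
Qed.

Lemma pair_measure_represents (R : realType) (beta : word -> R) (a1 a2 xi : R)
    (s : seq (R * (R * R))) :
  normalized beta -> 0 < xi -> uniq [seq p.2 | p <- s] ->
  (forall p, p \in s -> 0 < p.1) ->
  (forall w, (size w <= 4)%N -> beta w =
     xi * pair_seq a1 a2 w + \sum_(p <- s) p.1 * atom_moment (atom1 p.2) w) ->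
  represents (pair_measure a1 a2 xi s) beta.
Proof.
move=> b1 xi0 us s0 hb; split.
- rewrite /= -map_comp; apply/andP; split.
    by apply/negP => /mapP[p _ /(congr1 (@atom_size R))].
  have -> : [seq (snd \o (fun p => (p.1, atom1 p.2))) i | i <- s] =
      [seq atom1 z | z <- [seq p.2 | p <- s]] by rewrite -map_comp.
  by rewrite map_inj_uniq//; exact: atom1_inj.
- move=> p; rewrite inE => /predU1P[->|/mapP[q qs ->]]; split=> //=.
  + by split; rewrite //= ?Xmat_tr ?Ymat_tr.
  + exact: s0.
  + exact: atom1_valid.
- rewrite -b1 (hb [::])// big_cons big_map /= /pair_seq word_mx_nil.
  rewrite /ntrace mxtrace1 mulVf ?pnatr_eq0// mulr1; congr (_ + _).
  by apply: eq_bigr => p _; rewrite atom1_moment big_nil mulr1.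
- by move=> w /hb ->; rewrite big_cons big_map.
Qed.

Lemma pair_reduction_represents (R : realType) (beta : word -> R)
    (a1 a2 xi : R) :
  circle_seq beta -> normalized beta -> pair_reduction beta a1 a2 xi ->
  exists mu, represents mu beta.
Proof.
move=> cb nb [h1 h2 [xi0 _ _]]; rewrite moment_mx_sub => -[pM [gamma [_ cm]]].
have [cP _ _] := pair_seq_values h1 h2.
move: pM; set d := fun w => _ => pM /moment_mx_eqP dg _.
have cd : circle_seq d by exact: circle_seqD.
have e : d [:: lX; lX; lY; lY] = d [:: lX; lX] - d [:: lX; lX; lX; lX].
  by rewrite (circle_words cd).
have cmd : commutes4 d by rewrite /commutes4 -e !dg.
have [s [us s0 ds]] := circle_measure cd cmd pM.
exists (pair_measure a1 a2 xi s); apply: pair_measure_represents => //.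
  by move=> p /s0[].
by move=> w /ds <-; rewrite /d; ring.
Qed.

(** Rank 6 leaves a one-dimensional kernel, spanned by 1 - X^2 - Y^2. There X^2 and Y^2 have equal
    coefficients, in [form_vec] opposite ones, so only zero is common. *)
Lemma rank6_definite (R : realType) (beta : word -> R) (b0 b1 b2 : R) :
  circle_seq beta -> psdmx (moment_mx beta) -> \rank (moment_mx beta) = 6%N ->
  cform beta b0 b1 b2 0 0 0 = 0 -> [/\ b0 = 0, b1 = 0 & b2 = 0].
Proof.
move=> cb pb rk hv; set M := moment_mx beta in pb rk *.
have kerP (v : 'cV[R]_7) : (v^T *m M *m v) 0 0 = 0 -> (v^T <= kermx M)%MS.
  move=> v0; apply/sub_kermxP.
  by rewrite -[v^T *m M]trmxK trmx_mul pb.1 trmxK (psdmx_ker pb v0) trmx0.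
pose r : 'cV[R]_7 := \col_i [:: -1; 0; 0; 1; 0; 0; 1]`_i.
have rK : (r^T <= kermx M)%MS.
  apply: kerP; rewrite moment_form// !mxE /o7 !inordK//= /cform.
  by lra.
have r0 : r^T != 0.
  apply/eqP => /rowP/(_ 0); rewrite !mxE /= => /eqP.
  by rewrite oppr_eq0 oner_eq0.
have Kr : (kermx M <= r^T)%MS.
  have [_ <-] := mxrank_leqif_sup rK.
  by rewrite mxrank_ker rk rank_rV r0.
pose v := form_vec b0 b1 b2 0 0 0.
have : (v^T <= r^T)%MS.
  by apply: submx_trans Kr; apply: kerP; rewrite moment_form_vec.
move=> /sub_rVP[c vr].
have E k : (k < 7)%N -> [:: b0; 0; 0; b1; b2 + 0; b2 - 0; - b1]`_k =
    c * [:: -1; 0; 0; 1; 0; 0; 1]`_k.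
  by move=> k7; have /rowP/(_ (inord k)) := vr; rewrite !mxE inordK.
have := E 0 isT; have := E 3 isT; have := E 4 isT; have := E 6 isT; rewrite /=.
by move=> e6 e4 e3 e0; split; lra.
Qed.

(** * Measures for vanishing odd moments *)

Lemma quadratic_root (R : realType) (A B C x0 : R) :
  0 < A -> A * x0 ^+ 2 + B * x0 + C < 0 ->
  exists x, A * x ^+ 2 + B * x + C = 0.
Proof.
move=> A0 neg; pose D := B ^+ 2 - 4 * A * C.
have D0 : 0 <= D.
  have : 4 * A * (A * x0 ^+ 2 + B * x0 + C) < 0 by rewrite pmulr_rlt0// mulr_gt0.
  by have := sqr_ge0 (2 * A * x0 + B); rewrite /D; lra.
exists ((- B + Num.sqrt D) / (2 * A)).
have -> : A * ((- B + Num.sqrt D) / (2 * A)) ^+ 2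
    + B * ((- B + Num.sqrt D) / (2 * A)) + C
    = (Num.sqrt D ^+ 2 - D) / (4 * A) by rewrite /D; field; rewrite gt_eqF.
by rewrite sqr_sqrtr// subrr mul0r.
Qed.

(* Deflate the form e along k = c - u, with c chosen so that the residual form
   annihilates 1 - u^2 - v^2 as well as k.  The residual then lives on the chord
   u = c of the disc and is carried by its end points (c, s) and (c, -s). *)
Lemma chord_decomposition (R : realType) (u v uu uv vv : R) :
  let e b0 b1 b2 := b0 ^+ 2 + uu * b1 ^+ 2 + vv * b2 ^+ 2
    + 2 * (u * b0 * b1 + v * b0 * b2 + uv * b1 * b2) in
  (forall b0 b1 b2, 0 <= e b0 b1 b2) ->
  (forall b0 b1 b2, e b0 b1 b2 = 0 -> [/\ b0 = 0, b1 = 0 & b2 = 0]) ->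
  0 < 1 - uu - vv ->
  exists p q xi c s w1 w2 : R, [/\ p ^+ 2 + q ^+ 2 < 1, 0 < xi,
    [/\ - 1 < c < 1, 0 < s, s ^+ 2 = 1 - c ^+ 2, 0 < w1 & 0 < w2],
    [/\ 1 = xi + (w1 + w2), u = xi * p + (w1 + w2) * c &
        v = xi * q + (w1 - w2) * s] &
    [/\ uu = xi * p ^+ 2 + (w1 + w2) * c ^+ 2,
        uv = xi * (p * q) + (w1 - w2) * (c * s) &
        vv = xi * q ^+ 2 + (w1 + w2) * s ^+ 2]].
Proof.
move=> e e0 e1 w0.
have epos b0 b1 b2 : (b1 != 0) || (b2 != 0) -> 0 < e b0 b1 b2.
  move=> nz; rewrite lt_neqAle e0 andbT eq_sym; apply/eqP => /e1[_ z1 z2].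
  by move: nz; rewrite z1 z2 eqxx.
have du : 0 < uu - u ^+ 2.
  by have := @epos (- u) 1 0; rewrite oner_eq0 /e => /(_ isT); lra.
pose w := 1 - uu - vv.
(* Up to the positive factor N below, F c is minus the value on 1 - u^2 - v^2 of the residual form
   after deflating along c - u. *)
pose F c := (u - c) ^+ 2 - (uu - c * u) ^+ 2 - (uv - c * v) ^+ 2
  - w * (uu - 2 * c * u + c ^+ 2).
have [c Fc] : exists c, F c = 0.
  (* The leading coefficient is the sum of the variances of u and v, hence positive, while F is
     negative at c = u. *)
  have [||c hc] := @quadratic_root R (uu + vv - u ^+ 2 - v ^+ 2)
    (- 2 * u + 2 * u * uu + 2 * v * uv + 2 * u * w)
    (u ^+ 2 - uu ^+ 2 - uv ^+ 2 - w * uu) u.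
  - by have := @epos (- v) 0 1; rewrite oner_eq0 orbT /e => /(_ isT); lra.
  - have : 0 < w * (uu - u ^+ 2) by rewrite mulr_gt0.
    have := sqr_ge0 (uu - u ^+ 2); have := sqr_ge0 (uv - u * v).
    by rewrite /w; lra.
  - by exists c; rewrite -hc /F /w; ring.
have cu : u - c != 0.
  apply/negP => /eqP cu; have uc : c = u by lra.
  have : 0 < w * (uu - u ^+ 2) by rewrite mulr_gt0.
  have := sqr_ge0 (uu - u ^+ 2); have := sqr_ge0 (uv - u * v).
  by move: Fc; rewrite uc /F; lra.
pose N := uu - 2 * c * u + c ^+ 2.
have N0 : 0 < N.
  have := @epos (- c) 1 0; rewrite oner_eq0 /e => /(_ isT).
  by rewrite /N; lra.
have Nn0 : N != 0 by rewrite gt_eqF.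
have uuE : uu = N + 2 * c * u - c ^+ 2 by rewrite /N; ring.
(* The rank-one term removed by the deflation is the product of the pairings of k, normalized to xi
   times the square of evaluation at (p, q). Below, m and l are the residual moments of 1 and v. *)
pose p := (uu - c * u) / (u - c); pose q := (uv - c * v) / (u - c).
pose xi := (u - c) ^+ 2 / N.
have xi0 : 0 < xi by rewrite divr_gt0// exprn_even_gt0.
pose m := (uu - u ^+ 2) / N; have m0 : 0 < m by rewrite divr_gt0.
pose l := v - (u - c) * (uv - c * v) / N.
have wE : xi * (1 - p ^+ 2 - q ^+ 2) = w.
  have -> : xi * (1 - p ^+ 2 - q ^+ 2) = (F c + w * N) / N.
    by rewrite /xi /p /q /F -/N; field; rewrite cu Nn0.
  by rewrite Fc add0r mulfK.
have pq : p ^+ 2 + q ^+ 2 < 1.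
  suff : 0 < 1 - p ^+ 2 - q ^+ 2 by lra.
  by rewrite -(pmulr_rgt0 _ xi0) wE.
have E1 : 1 = xi + m by rewrite /xi /m uuE; field; rewrite Nn0.
have Eu : u = xi * p + m * c by rewrite /xi /m /p uuE; field; rewrite cu Nn0.
have Euu : uu = xi * p ^+ 2 + m * c ^+ 2.
  by rewrite /xi /m /p uuE; field; rewrite cu Nn0.
have Ev : v = xi * q + l by rewrite /xi /l /q; field; rewrite cu Nn0.
have Euv : uv = xi * (p * q) + l * c.
  by rewrite /xi /l /p /q uuE; field; rewrite cu Nn0.
have Evv : vv = xi * q ^+ 2 + m * (1 - c ^+ 2).
  have : vv = 1 - uu - w by rewrite /w; ring.
  by rewrite -wE {1}E1 {1}Euu => ->; ring.
have hl : l ^+ 2 < m ^+ 2 * (1 - c ^+ 2).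
  (* Chosen so that x (u - c) + m v - l is orthogonal to k; the full form there equals the residual
     one, and definiteness makes it positive. *)
  pose x := - (m * (uv - c * v) - l * (u - c)) / N.
  have := @epos (- l - x * c) x m; rewrite (gt_eqF m0) orbT => /(_ isT).
  have -> : e (- l - x * c) x m =
      m * (m * (vv - (uv - c * v) ^+ 2 / N) - l ^+ 2).
    by rewrite /e /x /l /m uuE; field; rewrite Nn0.
  have <- : xi * q ^+ 2 = (uv - c * v) ^+ 2 / N.
    by rewrite /xi /q; field; rewrite cu Nn0.
  by rewrite pmulr_rgt0// {1}Evv; lra.
have c0 : 0 < 1 - c ^+ 2.
  rewrite -(pmulr_rgt0 _ (exprn_gt0 2 m0)); have := sqr_ge0 l; lra.
pose s := Num.sqrt (1 - c ^+ 2).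
have s0 : 0 < s by rewrite sqrtr_gt0.
have s2 : s ^+ 2 = 1 - c ^+ 2 by rewrite sqr_sqrtr// ltW.
have : `|l| < m * s.
  have ms0 : 0 <= m * s by rewrite mulr_ge0// ltW.
  rewrite -(ltr_pXn2r (n := 2)) ?nnegrE//.
  by rewrite real_normK ?num_real// exprMn s2.
rewrite ltr_norml => /andP[l1 l2].
have c1 : -1 < c < 1.
  rewrite -ltr_norml -(ltr_pXn2r (n := 2)) ?nnegrE ?ler01//.
  by rewrite real_normK ?num_real// expr1n; lra.
have sn0 : s != 0 by rewrite gt_eqF.
exists p, q, xi, c, s, ((m + l / s) / 2), ((m - l / s) / 2).
have -> : (m + l / s) / 2 + (m - l / s) / 2 = m by field.
have E : ((m + l / s) / 2 - (m - l / s) / 2) * s = l by field.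
split=> //.
- split=> //; rewrite divr_gt0//.
    by rewrite -(pmulr_lgt0 _ s0) mulrDl divfK//; lra.
  by rewrite -(pmulr_lgt0 _ s0) mulrBl divfK//; lra.
- by split=> //; rewrite E.
- split=> //; last by rewrite s2.
  by rewrite [c * s]mulrC (mulrA _ s c) E.
Qed.

Lemma odd_free_measure (R : realType) (beta : word -> R) :
  circle_seq beta -> normalized beta -> psdmx (moment_mx beta) ->
  \rank (moment_mx beta) = 6%N -> odd_free beta ->
  beta [:: lX; lX; lY; lY] <> beta [:: lX; lY; lX; lY] ->
  exists a1 a2 xi s, represents (pair_measure a1 a2 xi s) beta /\ size s = 4%N.
Proof.
move=> cb nb pb rk fo nc; have b1 : beta [::] = 1 := nb.
have F := (psd_momentP cb).1 pb.
have ev c0 c1 c2 c3 c4 c5 := cform_odd_free c0 c1 c2 c3 c4 c5 fo.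
pose u := 2 * beta [:: lX; lX] - 1; pose v := 2 * beta [:: lX; lY].
pose uu := 4 * beta [:: lX; lX; lX; lX] - 4 * beta [:: lX; lX] + 1.
pose uv := 4 * beta [:: lX; lX; lX; lY] - 2 * beta [:: lX; lY].
pose vv := 2 * beta [:: lX; lY; lX; lY]
  + 2 * (beta [:: lX; lX] - beta [:: lX; lX; lX; lX]).
have w0 : 0 < 1 - uu - vv.
  rewrite lt_neqAle; apply/andP; split.
    by apply/eqP => e; apply: nc; rewrite (circle_words cb); move: e;
      rewrite /uu /vv; lra.
  by have := F 0 0 0 1 0 0; rewrite ev /even_form b1 -/u -/v -/uu -/uv -/vv; lra.
have eE c0 c1 c2 : cform beta c0 c1 c2 0 0 0 =
    c0 ^+ 2 + uu * c1 ^+ 2 + vv * c2 ^+ 2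
    + 2 * (u * c0 * c1 + v * c0 * c2 + uv * c1 * c2).
  by rewrite ev /even_form b1 -/u -/v -/uu -/uv -/vv; ring.
have [||p [q [xi [c [s [w1 [w2 [pq xi0 [/andP[c1 c2] s0 s2 w10 w20] [E1 Eu Ev]
    [Euu Euv Evv]]]]]]]]] := @chord_decomposition R u v uu uv vv _ _ w0.
- by move=> d0 d1 d2; rewrite -eE.
- by move=> d0 d1 d2; rewrite -eE; exact: rank6_definite.
(* Half-angle formulas: (x, y) is the point of the circle with x^2 - y^2 = c and 2xy = s. Strictness
   of -1 < c < 1 makes the four points below distinct. *)
pose x := Num.sqrt ((1 + c) / 2); pose y := Num.sqrt ((1 - c) / 2).
have x2 : x ^+ 2 = (1 + c) / 2 by rewrite sqr_sqrtr//; lra.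
have y2 : y ^+ 2 = (1 - c) / 2 by rewrite sqr_sqrtr//; lra.
have x0 : 0 < x by rewrite sqrtr_gt0; lra.
have y0 : 0 < y by rewrite sqrtr_gt0; lra.
have xy : x * y = s / 2.
  apply/eqP; rewrite -(eqrXn2 (n := 2))//; last 2 first.
  - by rewrite ltW// mulr_gt0.
  - by rewrite ltW// divr_gt0.
  by rewrite exprMn x2 y2 expr_div_n s2; apply/eqP; field.
(* Antipodal points share u and v, and equal weights cancel their odd moments. *)
pose z := [:: (w1 / 2, (x, y)); (w1 / 2, (- x, - y));
              (w2 / 2, (x, - y)); (w2 / 2, (- x, y))].
have [h1 h2] := disc_param pq.
have [cP [o1 o2 o3 o4] [e1 e2 e3 e4 [e5 e6]]] := pair_seq_values h1 h2.
exists ((1 + p) / 2), q, xi, z; split=> //.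
have [b1X b1Y bXXX bXXY] := fo.
have cz : circle_seq (fun w => \sum_(r <- z) r.1 * atom_moment (atom1 r.2) w).
  apply: circle_seq_sum => r; rewrite !inE => rz; apply: atom1_circle.
  by move: rz => /or4P[] /eqP -> /=; rewrite ?sqrrN x2 y2; field.
have xn : (x == - x) = false by apply/negbTE/eqP; lra.
have yn : (y == - y) = false by apply/negbTE/eqP; lra.
have nx : (- x == x) = false by apply/negbTE/eqP; lra.
have ny : (- y == y) = false by apply/negbTE/eqP; lra.
apply: pair_measure_represents => //.
- by rewrite /= !inE !xpair_eqE xn yn nx ny !eqxx /=.
- by move=> r; rewrite !inE => /or4P[] /eqP -> /=; rewrite divr_gt0.
have cs : circle_seq (fun w => xi * pair_seq ((1 + p) / 2) q w
    + 1 * \sum_(r <- z) r.1 * atom_moment (atom1 r.2) w) by exact: circle_seqD.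
have zE w : \sum_(r <- z) r.1 * atom_moment (atom1 r.2) w =
    w1 / 2 * (\prod_(l <- w) (if l == lX then x else y)
              + \prod_(l <- w) (if l == lX then - x else - y))
    + w2 / 2 * (\prod_(l <- w) (if l == lX then x else - y)
              + \prod_(l <- w) (if l == lX then - x else y)).
  by rewrite /z !big_cons big_nil /= !atom1_moment; ring.
move=> w sw; rewrite -[X in _ + X]mul1r; move: w sw.
apply: (circle_seq_ext cb cs); rewrite zE ?big_cons !big_nil /=.
- rewrite b1 e1; lra.
- by rewrite b1X o1; ring.
- by rewrite b1Y o2; ring.
- rewrite e2; transitivity (xi * ((1 + p) / 2) + (w1 + w2) * x ^+ 2); last by field.
  by rewrite x2; move: E1 Eu; rewrite /u; lra.
- rewrite e3; transitivity (xi * (q / 2) + (w1 - w2) * (x * y)); last by field.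
  by rewrite xy; move: Ev; rewrite /v; lra.
- by rewrite bXXX o3; ring.
- by rewrite bXXY o4; ring.
- rewrite e4; transitivity (xi * ((1 + p) / 2) ^+ 2 + (w1 + w2) * (x ^+ 2) ^+ 2).
    by rewrite x2; move: E1 Eu Euu; rewrite /uu /u; lra.
  by field.
- rewrite e5; transitivity (xi * ((1 + p) / 2 * q / 2)
      + (w1 - w2) * (x ^+ 2 * (x * y))); last by field.
  by rewrite x2 xy; move: Ev Euv; rewrite /uv /v; lra.
- rewrite e6; transitivity (xi * (q ^+ 2 / 2 - (1 + p) / 2 * (1 - (1 + p) / 2))
      + (w1 + w2) * (x * y) ^+ 2); last by field.
  rewrite xy expr_div_n.
  have := congr1 (fun t => (w1 + w2) * t) s2.
  by move: E1 Eu Euu Evv; rewrite /vv /uu /u; lra.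
Qed.

(** * Minimal types *)

(** The order on types looks at the last entry first. So the last entry is minimized, and the
    induction runs on the prefixes that can precede this minimum. *)
Lemma lex_minimal (S : seq nat -> Prop) (r : nat) :
  (exists m, S m /\ size m = r) ->
  exists m, [/\ S m, size m = r & forall m', S m' -> size m' = r ->
    ~ exists k, (nth 0 m' k < nth 0 m k)%N /\
       forall j, (k < j)%N -> nth 0%N m' j = nth 0%N m j].
Proof.
elim: r S => [|r IH] S [m [Sm sm]].
  by exists m; split=> // m' _ _ [k]; rewrite (size0nil sm) nth_nil ltn0 => -[].
pose P x := `[< exists m0, S (rcons m0 x) /\ size m0 = r >].
have exP : exists x, P x.
  case/lastP: m Sm sm => // m0 x Sm; rewrite size_rcons => -[sm].
  by exists x; apply/asboolP; exists m0.
case: (ex_minnP exP) => x /asboolP /(IH (fun m0 => S (rcons m0 x))).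
move=> [m0 [Sm0 sm0 m0min]] xmin.
exists (rcons m0 x); split; rewrite ?size_rcons ?sm0// => m' Sm' sm' [k [lt eq]].
case/lastP: m' Sm' sm' lt eq => // m1 y Sm1; rewrite size_rcons => -[sm1].
rewrite !nth_rcons sm0 sm1; have [kr|kr|->] := ltngtP k r => //; last first.
  move=> yx _; have := xmin y.
  by rewrite leqNgt yx => /(_ _)/negP; apply=> //; apply/asboolP; exists m1.
move=> lt eq; have yx : y = x.
  by have := eq r kr; rewrite !nth_rcons sm0 sm1 ltnn eqxx.
rewrite yx in Sm1; apply: (m0min m1 Sm1 sm1); exists k; split=> // j kj.
have := eq j kj; rewrite !nth_rcons sm0 sm1; case: ltngtP => // jr _.
  by rewrite !nth_default ?sm0 ?sm1 ?(ltnW jr).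
by rewrite !nth_default ?sm0 ?sm1 ?jr.
Qed.

Lemma represents_type (R : realType) (beta : word -> R) (mu : measure R) :
  represents mu beta -> exists m, has_type mu m.
Proof.
move=> [_ hmu sum1 _].
case: mu hmu sum1 => [|p0 mu0]; first by rewrite big_nil => _ /eqP; rewrite eq_sym oner_eq0.
set mu := p0 :: mu0 => hmu _.
pose P k := has (fun p => atom_size p.2 == k) mu.
have exP : exists k, P k by exists (atom_size p0.2); rewrite /P /= eqxx.
have ubP k : P k -> (k <= \max_(p <- mu) atom_size p.2)%N.
  by move=> /hasP[p pmu /eqP <-]; apply: leq_bigmax_seq.
case: (ex_maxnP exP ubP) => r Pr rmax.
have r0 : (0 < r)%N.
  by move: Pr => /hasP[p /hmu[_ [+ _ _]] /eqP <-].
exists (mkseq (fun i => count (fun p => atom_size p.2 == i.+1) mu) r); split.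
  rewrite (last_nth 0%N) size_mkseq -(prednK r0) /= nth_mkseq// prednK//.
  by move: Pr; rewrite /P has_count lt0n => /eqP.
move=> i; have [ir|ri] := ltnP i r; first by rewrite nth_mkseq.
rewrite nth_default ?size_mkseq//; apply/eqP; rewrite -leqn0 leqNgt -has_count.
by apply/negP => /rmax; rewrite ltnNge ri.
Qed.

(** The length of the type is minimized first, then the type among those of that length. If the
    length were 1, all atoms would be scalar pairs, which commute, against the nc hypothesis. *)
Lemma represents_admits (R : realType) (beta : word -> R) (mu : measure R) :
  beta [:: lX; lX; lY; lY] <> beta [:: lX; lY; lX; lY] ->
  represents mu beta -> admits_nc_measure beta.
Proof.
move=> nc hmu.
pose S m := exists nu, represents nu beta /\ has_type nu m.
have [m0 hm0] := represents_type hmu.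
pose P r := `[< exists m, S m /\ size m = r >].
have exP : exists r, P r.
  by exists (size m0); apply/asboolP; exists m0; split=> //; exists mu.
case: (ex_minnP exP) => r /asboolP /lex_minimal[m [[nu [hnu tnu]] sm mmin]] rmin.
exists nu, m; split.
  split=> // nu' m' hnu' tnu' [lt|[eqs lex]].
    have := rmin (size m'); rewrite -sm leqNgt lt => /(_ _)/negP; apply=> //.
    by apply/asboolP; exists m'; split=> //; exists nu'.
  by apply: (mmin m') => //; [exists nu' | rewrite eqs].
rewrite ltnNge; apply/negP => m1; apply: nc.
have [_ hat _ mom] := hnu; rewrite !mom// big_seq [RHS]big_seq.
apply: eq_bigr => p pnu; congr (_ * _).
have : atom_size p.2 = 1%N.
  have [_ [s0 _ _]] := hat p pnu; apply/eqP; rewrite eqn_leq s0 andbT leqNgt.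
  (* A larger atom would be counted at an index past the end of m, where the default entry is 0. *)
  apply/negP => s2; have := tnu.2 (atom_size p.2).-1.
  rewrite nth_default; last by rewrite (leq_trans m1)// -ltnS prednK.
  move/eqP; rewrite -leqn0 leqNgt -has_count => /negP; apply.
  by apply/hasP; exists p; rewrite //= prednK.
case: (p.2) => t [A B]; rewrite /atom_size /= => t1; subst t.
rewrite /atom_moment !word_mx_cons word_mx_nil /= !mulmx1.
by rewrite [A]mx11_scalar [B]mx11_scalar -!scalar_mxM; congr (ntrace _%:M); ring.
Qed.

Theorem theorem7p5 (R : realType) (beta : word -> R)
  (hnc : nc_seq beta) (hnorm : normalized beta)
  (hrank : \rank (moment_mx beta) = 6%N)
  (hrel : mcol (moment_mx beta) [:: lY; lY] =
          mcol (moment_mx beta) [::] - mcol (moment_mx beta) [:: lX; lX]) :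
  let M2 := moment_mx beta in
  let case1 := [/\ beta [:: lX] = 0, beta [:: lY] = 0,
                   beta [:: lX; lX; lX] = 0 & beta [:: lX; lX; lY] = 0] in
  let case2 := exists a1 a2 xi : R,
    let M2XY := pair_moment_mx (Xmat a1) (Ymat a1 a2) in
    let M := M2 - xi *: M2XY in
    [/\ 0 < a1 < 1,
        - (2 * Num.sqrt (a1 * (1 - a1))) < a2 < 2 * Num.sqrt (a1 * (1 - a1)),
        [/\ 0 < xi, (\rank M < \rank M2)%N
          & forall eta : R, 0 < eta ->
              (\rank (M2 - eta *: M2XY)%R < \rank M2)%N -> xi <= eta]
      & [/\ psdmx M, cm_moment_mx M
          & (`I_(\rank M) #<= variety M)%card]] in
  (admits_nc_measure beta <-> psdmx M2 /\ (case1 \/ case2)) /\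
  (psdmx M2 /\ case1 ->
     exists mu : measure R, represents mu beta /\ has_type mu [:: 4%N; 1%N]).
Proof.
move=> M2 case1 case2; have [tb nc] := hnc.
have cb := circle_seq_of_rel tb hrel.
have type41 : psdmx M2 /\ case1 ->
    exists mu : measure R, represents mu beta /\ has_type mu [:: 4%N; 1%N].
  move=> [pb c1]; have [a1 [a2 [xi [s [hs s4]]]]] :=
    odd_free_measure cb hnorm pb hrank c1 nc.
  exists (pair_measure a1 a2 xi s); split=> //.
  by rewrite -s4; exact: pair_measure_type.
split=> //; split.
  move=> [mu [m [[hmu _ _] _]]].
  have [f [h split_fh]] := split_measure (represents_circle cb hmu).
  have [_ _ _ mom] := hmu.
  have pb : psdmx M2.
    have [cf ch [pf ph] _ gE] := split_fh.
    rewrite /M2 (_ : moment_mx beta = moment_mx (fun w => 1 * f w + 1 * h w)).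
      by apply: psd_lin; rewrite ?ler01.
    by apply/moment_mx_eqP => w sw; rewrite mom// gE !mul1r.
  (* Every representing measure, whatever its odd moments, yields case (2). *)
  split=> //; right.
  exact: pair_reduction_of_split cb pb nc mom split_fh.
move=> [pb [c1|[a1 [a2 [xi red]]]]].
  by have [mu [hmu _]] := type41 (conj pb c1); exact: represents_admits nc hmu.
have [mu hmu] := pair_reduction_represents cb hnorm red.
exact: represents_admits nc hmu.
Qed.
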